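(* Let $\mathcal U$ be an $\mathfrak h$-algebra and $\mathcal A$ an $\mathfrak h$-coalgebroid equipped with a pairing $\langle\cdot,\cdot\rangle:\mathcal U\times\mathcal A\to D_{\mathfrak h^*}$, and let $V$ be an $\mathfrak h$-space. (i) Let $R:V\to V\widetilde\otimes\mathcal A$ be a right corepresentation of $\mathcal A$. Then $\pi(X)v=(\mathrm{Id}\otimes\langle X,\cdot\rangle T_\beta)R(v)$ for $X\in\mathcal U_{\alpha\beta}$ defines an $\mathfrak h$-algebra homomorphism $\pi:\mathcal U\to(D_{\mathfrak h^*,V})^{\mathrm{lr}}$; hence $\pi:\mathcal U^{\mathrm{lr}}\to D_{\mathfrak h^*,V}$ is a dynamical representation of $\mathcal U^{\mathrm{lr}}$ on $V$. (ii) Let $L:V\to\mathcal A\widetilde\otimes V$ be a left corepresentation of $\mathcal A$. Then $\pi(X)v=(T_\alpha\langle X,\cdot\rangle\otimes\mathrm{Id})L(v)$ for $X\in\mathcal U_{\alpha\beta}$ defines an $\mathfrak h$-algebra homomorphism $\pi:\mathcal U^{\mathrm{opp}}\to(D_{\mathfrak h^*,V})^{\mathrm{lr}}$; in particular $\pi:(\mathcal U^{\mathrm{opp}})^{\mathrm{lr}}\to D_{\mathfrak h^*,V}$ is a dynamical representation of $(\mathcal U^{\mathrm{opp}})^{\mathrm{lr}}$ on $V$. Moreover, if $\mathcal U$ is an $\mathfrak h$-Hopf algebroid, then $X\mapsto\pi(S^{\mathcal U}(X))$ defines a dynamical representation of $\mathcal U$ on $V$.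
   Context: $\mathfrak h$ is a finite-dimensional complex vector space (viewed as a commutative Lie algebra) with dual $\mathfrak h^*$; $M_{\mathfrak h^*}$ is the field of meromorphic functions on $\mathfrak h^*$; $\mathbf 1$ is the constant function $1$; $(T_\alpha f)(\lambda)=f(\lambda+\alpha)$. An $\mathfrak h$-prealgebra is a complex vector space $\mathcal A=\bigoplus_{\alpha,\beta\in\mathfrak h^*}\mathcal A_{\alpha\beta}$ with two commuting left actions $\mu_l^{\mathcal A},\mu_r^{\mathcal A}$ of $M_{\mathfrak h^*}$ (moment maps) preserving the decomposition. An $\mathfrak h$-algebra is an $\mathfrak h$-prealgebra that is a bigraded unital associative algebra such that the moment maps are left multiplication by $\mu_l^{\mathcal A}(f),\mu_r^{\mathcal A}(f)\in\mathcal A_{00}$, giving algebra embeddings, with $\mu_l^{\mathcal A}(f)a=a\mu_l^{\mathcal A}(T_\alpha f)$, $\mu_r^{\mathcal A}(f)a=a\mu_r^{\mathcal A}(T_\beta f)$ for $a\in\mathcal A_{\alpha\beta}$. Homomorphisms preserve all structure. $\mathcal A^{\mathrm{lr}}$ is $\mathcal A$ with interchanged moment maps and $(\mathcal A^{\mathrm{lr}})_{\alpha\beta}=\mathcal A_{\beta\alpha}$; $\mathcal A^{\mathrm{opp}}$ is the opposite algebra with the same moment maps and $(\mathcal A^{\mathrm{opp}})_{\alpha\beta}=\mathcal A_{-\alpha,-\beta}$. $D_{\mathfrak h^*}$ is the $\mathfrak h$-algebra of finite difference operators $\sum_if_iT_{\alpha_i}$ on $M_{\mathfrak h^*}$ with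 $fT_{-\alpha}\in(D_{\mathfrak h^*})_{\alpha\alpha}$, $(D_{\mathfrak h^*})_{\alpha\beta}=0$ for $\alpha\neq\beta$, both moment maps being multiplication operators. $\mathcal A\widetilde\otimes\mathcal B$ has $(\mathcal A\widetilde\otimes\mathcal B)_{\alpha\beta}=\bigoplus_\gamma\mathcal A_{\alpha\gamma}\otimes\mathcal B_{\gamma\beta}$ modulo $\mu_r^{\mathcal A}(f)a\otimes b=a\otimes\mu_l^{\mathcal B}(f)b$, with moment maps $\mu_l^{\mathcal A}(f)\otimes1$, $1\otimes\mu_r^{\mathcal B}(f)$ (and, for $\mathfrak h$-algebras, componentwise product); $\mathcal A\widetilde\otimes D_{\mathfrak h^*}\cong\mathcal A\cong D_{\mathfrak h^*}\widetilde\otimes\mathcal A$ via $a\otimes fT_{-\beta}=\mu_r^{\mathcal A}(f)a$, $fT_{-\alpha}\otimes a=\mu_l^{\mathcal A}(f)a$ for $a\in\mathcal A_{\alpha\beta}$. An $\mathfrak h$-coalgebroid is an $\mathfrak h$-prealgebra with $\mathfrak h$-prealgebra homomorphisms $\Delta:\mathcal A\to\mathcal A\widetilde\otimes\mathcal A$ (coassociative) and $\varepsilon:\mathcal A\to D_{\mathfrak h^*}$ with $(\varepsilon\otimes\mathrm{Id})\Delta=\mathrm{Id}=(\mathrm{Id}\otimes\varepsilon)\Delta$. An $\mathfrak h$-bialgebroid is an $\mathfrak h$-algebra and $\mathfrak h$-coalgebroid with $\Delta,\varepsilon$ $\mathfrak h$-algebra homomorphisms. An $\mathfrak h$-Hopf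 algebroid has in addition a $\mathbb C$-linear $S$ with $S(\mu_r(f)a)=S(a)\mu_l(f)$, $S(a\mu_l(f))=\mu_r(f)S(a)$, $m(\mathrm{Id}\otimes S)\Delta(a)=\mu_l(\varepsilon(a)\mathbf 1)$, and $m(S\otimes\mathrm{Id})\Delta(a)=\mu_r(T_\alpha(\varepsilon(a)\mathbf 1))$ for $a\in\mathcal A_{\alpha\beta}$; then $S$ is antimultiplicative, interchanges the moment maps, and $S(\mathcal A_{\alpha\beta})\subseteq\mathcal A_{-\beta,-\alpha}$. A pairing between an $\mathfrak h$-algebra $\mathcal U$ and an $\mathfrak h$-coalgebroid $\mathcal A$ is a $\mathbb C$-bilinear map $\mathcal U\times\mathcal A\to D_{\mathfrak h^*}$ with: $\langle\mathcal U_{\alpha\beta},\mathcal A_{\gamma\delta}\rangle\subseteq(D_{\mathfrak h^*})_{\alpha+\delta,\beta+\gamma}$; $\langle\mu_l^{\mathcal U}(f)X,a\rangle=\langle X,\mu_l^{\mathcal A}(f)a\rangle=f\circ\langle X,a\rangle$; $\langle X\mu_r^{\mathcal U}(f),a\rangle=\langle X,a\mu_r^{\mathcal A}(f)\rangle=\langle X,a\rangle\circ f$, where $a\mu_r^{\mathcal A}(f):=\mu_r^{\mathcal A}(T_{-\delta}f)a$ for $a\in\mathcal A_{\gamma\delta}$; $\langle XY,a\rangle=\sum\langle X,a_{(1)}\rangle T_\rho\langle Y,a_{(2)}\rangle$ with $\Delta(a)=\sum a_{(1)}\otimes a_{(2)}$, $a_{(1)}\in\mathcal A_{\gamma\rho}$;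 and $\langle1,a\rangle=\varepsilon^{\mathcal A}(a)$. An $\mathfrak h$-space is a vector space $V=\bigoplus_{\alpha\in\mathfrak h^*}V_\alpha$ over $M_{\mathfrak h^*}$, a diagonalisable $\mathfrak h$-module with weight spaces $V_\alpha$, and $M_{\mathfrak h^*}V_\alpha\subseteq V_\alpha$; morphisms are $M_{\mathfrak h^*}$-linear and $\mathfrak h$-invariant. $\mathcal A\widetilde\otimes V=\bigoplus_{\alpha,\beta}\mathcal A_{\alpha\beta}\otimes V_\beta$ modulo $\mu_r^{\mathcal A}(f)a\otimes v=a\otimes fv$, with $\mathcal A_{\alpha\beta}\otimes V_\beta$ of weight $\alpha$ and $f(a\otimes v)=\mu_l^{\mathcal A}(f)a\otimes v$. $V\widetilde\otimes\mathcal A=\bigoplus_{\alpha,\beta}V_\alpha\otimes\mathcal A_{\alpha\beta}$ modulo $v\otimes\mu_l^{\mathcal A}(f)a=fv\otimes a$, with $V_\alpha\otimes\mathcal A_{\alpha\beta}$ of weight $\beta$ and $f(v\otimes a)=v\otimes\mu_r^{\mathcal A}(f)a$. $V\widetilde\otimes D_{\mathfrak h^*}\cong V\cong D_{\mathfrak h^*}\widetilde\otimes V$ via $v\otimes fT_{-\alpha}\cong fv\cong fT_{-\alpha}\otimes v$ for $v\in V_\alpha$. A left corepresentation is an $\mathfrak h$-space morphism $L:V\to\mathcal A\widetilde\otimes V$ with $(\Delta\otimes\mathrm{Id})L=(\mathrm{Id}\otimes L)L$, $(\varepsilon\otimes\mathrm{Id})L=\mathrm{Id}$; a right corepresentation is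 an $\mathfrak h$-space morphism $R:V\to V\widetilde\otimes\mathcal A$ with $(R\otimes\mathrm{Id})R=(\mathrm{Id}\otimes\Delta)R$, $(\mathrm{Id}\otimes\varepsilon)R=\mathrm{Id}$. $D_{\mathfrak h^*,V}=\bigoplus_{\alpha,\beta}(D_{\mathfrak h^*,V})_{\alpha\beta}$ is the $\mathfrak h$-algebra where $(D_{\mathfrak h^*,V})_{\alpha\beta}$ consists of the $\mathbb C$-linear $U:V\to V$ with $U(fv)=(T_{-\beta}f)U(v)$ and $U(V_\gamma)\subseteq V_{\gamma-\alpha+\beta}$, with $\mu_r(f)v=fv$ and $\mu_l(f)v=(T_{-\gamma}f)v$ for $v\in V_\gamma$. A dynamical representation of an $\mathfrak h$-algebra $\mathcal A$ on $V$ is an $\mathfrak h$-algebra homomorphism $\mathcal A\to D_{\mathfrak h^*,V}$. $\pi(X)$ for general $X$ is defined by linear extension from homogeneous $X$. *)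

(* Defs.v *)
From HB Require Import structures.
From mathcomp Require Import all_boot all_order all_algebra.
From mathcomp Require Import generic_quotient ring_quotient complex.
From mathcomp Require Import all_classical all_reals all_analysis.
From mathcomp.multinomials Require Import freeg.

Set Implicit Arguments.
Unset Strict Implicit.
Unset Printing Implicit Defensive.

Import Order.TTheory GRing.Theory Num.Theory numFieldNormedType.Exports.
Import VectorInternalTheory.
Local Open Scope classical_set_scope.
Local Open Scope ring_scope.
Local Open Scope complex_scope.
Local Open Scope quotient_scope.

Definition dual (R : realType) (h : vectType R[i]) : Type := 'Hom(h, R[i]^o).

Section Dual.
Context (R : realType) (h : vectType R[i]).
HB.instance Definition _ := Vector.on (dual h).
HB.instance Definition _ := isPointed.Build (dual h) 0.

Definition coord_space : normedModType R[i] := 'rV[R[i]]_(dim (dual h)).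
Definition coords : dual h -> coord_space := v2r.
Definition of_coords : coord_space -> dual h := r2v.
HB.instance Definition _ := Topological.copy (dual h) (initial_topology coords).

(* Differentiability over the field R[i]; the choice of linear coordinates is
   immaterial. *)
Definition holomorphic_on (U : set (dual h)) (f : dual h -> R[i]) : Prop :=
  forall x, U x ->
    differentiable ((fun z => f (of_coords z)) : coord_space -> R[i]^o)
      (coords x).

Lemma coordsK : cancel coords of_coords. Proof. exact: v2rK. Qed.
Lemma of_coordsK : cancel of_coords coords. Proof. exact: r2vK. Qed.

Lemma continuous_coords : continuous coords.
Proof. exact: initial_continuous. Qed.

Lemma holomorphic_cst U c : holomorphic_on U (fun=> c).
Proof. by move=> x _; exact: differentiable_cst. Qed.

Lemma holomorphicD U f g :
  holomorphic_on U f -> holomorphic_on U g -> holomorphic_on U (f + g).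
Proof. by move=> hf hg x Ux; apply: differentiableD; [exact: hf|exact: hg]. Qed.

Lemma holomorphicM U f g :
  holomorphic_on U f -> holomorphic_on U g -> holomorphic_on U (f * g).
Proof. by move=> hf hg x Ux; apply: differentiableM; [exact: hf|exact: hg]. Qed.

Lemma holomorphicS U U' f :
  U' `<=` U -> holomorphic_on U f -> holomorphic_on U' f.
Proof. by move=> sU hf x /sU /hf. Qed.

Lemma holomorphic_neq0 U f x : open U -> holomorphic_on U f -> U x ->
  f x != 0 -> exists O, [/\ open O, O `<=` U, O x & forall y, O y -> f y != 0].
Proof.
move=> oU hf Ux fx0.
have cf := differentiable_continuous (hf x Ux).
have fx0' : (f (of_coords (coords x)) : R[i]^o) != 0 by rewrite coordsK.
have n1 : \forall z \near coords x, (f (of_coords z) : R[i]^o) != 0.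
  exact: (cvgr_neq0 _ cf).
have n2 : \forall y \near x, f y != 0.
  have : \forall y \near x, (f (of_coords (coords y)) : R[i]^o) != 0.
    exact: continuous_coords n1.
  by apply: filterS => y; rewrite coordsK.
have : nbhs x (U `&` [set y | f y != 0]).
  by apply: filterI => //; exact: open_nbhs_nbhs.
rewrite nbhsE; case=> W [oW Wx] sW; exists W; split => //.
- by move=> y /sW[].
- by move=> y /sW[].
Qed.

Definition nonzero_near (U : set (dual h)) (q : dual h -> R[i]) : Prop :=
  forall O, open O -> O `<=` U -> O !=set0 -> exists2 y, O y & q y != 0.

Lemma nonzero_nearM U q U' q' : open U -> open U' ->
  holomorphic_on U q -> nonzero_near U q -> nonzero_near U' q' ->
  nonzero_near (U `&` U') (q * q').
Proof.
move=> oU oU' hq nq nq' W oW sW W0.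
have [x Wx qx] := nq W oW (fun x Wx => (sW x Wx).1) W0.
have [W' [oW' sW' W'x q0]] := holomorphic_neq0 oW
  (holomorphicS (fun x Wx => (sW x Wx).1) hq) Wx qx.
have [|y W'y q'y] := nq' W' oW' (fun x Wx => (sW x (sW' _ Wx)).2).
  by exists x.
by exists y; [exact: sW'|rewrite mulf_neq0 ?q0].
Qed.

(* A meromorphic function is locally a quotient of holomorphic functions whose
   denominator vanishes identically on no nonempty open set.  Its values at the
   zeros of the denominator are arbitrary; they are discarded when passing to
   the quotient [Mero] below. *)
Definition is_mero (f : dual h -> R[i]) : Prop :=
  forall x, exists U p q,
    [/\ open U /\ U x, holomorphic_on U p /\ holomorphic_on U q,
        nonzero_near U q & forall y, U y -> q y != 0 -> f y = p y / q y].

Lemma is_mero_cst c : is_mero (fun=> c).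
Proof.
move=> x; exists setT, (fun=> c), (fun=> 1); split.
- by split => //; exact: openT.
- by split; exact: holomorphic_cst.
- by move=> W _ _ [y Wy]; exists y; rewrite ?oner_neq0.
- by move=> y _ _; rewrite divr1.
Qed.

Lemma is_meroD f g : is_mero f -> is_mero g -> is_mero (f + g).
Proof.
move=> mf mg x.
have [U [p [q [[oU Ux] [hp hq] nq fE]]]] := mf x.
have [U' [p' [q' [[oU' U'x] [hp' hq'] nq' gE]]]] := mg x.
have sl := @subIsetl _ U U'; have sr := @subIsetr _ U U'.
exists (U `&` U'), (p * q' + p' * q), (q * q'); split.
- by split=> //; exact: openI.
- split; last first.
    by apply: holomorphicM; [exact: holomorphicS hq|exact: holomorphicS hq'].
  apply: holomorphicD; apply: holomorphicM.
  + exact: holomorphicS hp.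
  + exact: holomorphicS hq'.
  + exact: holomorphicS hp'.
  + exact: holomorphicS hq.
- exact: nonzero_nearM.
- move=> y [Uy U'y]; rewrite /= mulf_eq0 negb_or => /andP[qy q'y].
  change (f y + g y = (p y * q' y + p' y * q y) / (q y * q' y)).
  by rewrite fE// gE// addf_div.
Qed.

Lemma is_meroM f g : is_mero f -> is_mero g -> is_mero (f * g).
Proof.
move=> mf mg x.
have [U [p [q [[oU Ux] [hp hq] nq fE]]]] := mf x.
have [U' [p' [q' [[oU' U'x] [hp' hq'] nq' gE]]]] := mg x.
have sl := @subIsetl _ U U'; have sr := @subIsetr _ U U'.
exists (U `&` U'), (p * p'), (q * q'); split.
- by split=> //; exact: openI.
- split; apply: holomorphicM.
  + exact: holomorphicS hp.
  + exact: holomorphicS hp'.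
  + exact: holomorphicS hq.
  + exact: holomorphicS hq'.
- exact: nonzero_nearM.
- move=> y [Uy U'y]; rewrite /= mulf_eq0 negb_or => /andP[qy q'y].
  change (f y * g y = (p y * p' y) / (q y * q' y)).
  by rewrite fE// gE// mulf_div.
Qed.

Definition merob : pred (dual h -> R[i]) := fun f => `[< is_mero f >].

Lemma merob_subring : subring_closed merob.
Proof.
split.
- exact/asboolP/is_mero_cst.
- move=> f g /asboolP mf /asboolP mg; apply/asboolP.
  have -> : f - g = f + (fun=> -1) * g.
    by apply/funext => y; rewrite !fctE mulN1r.
  by apply: is_meroD => //; apply: is_meroM => //; exact: is_mero_cst.
- by move=> f g /asboolP mf /asboolP mg; apply/asboolP; exact: is_meroM.
Qed.
HB.instance Definition _ :=
  GRing.isSubringClosed.Build (dual h -> R[i]) merob merob_subring.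

Definition premero := {f : dual h -> R[i] | f \in merob}.
HB.instance Definition _ := SubType.on premero.
HB.instance Definition _ := Choice.on premero.
HB.instance Definition _ := [SubChoice_isSubComNzRing of premero by <:].

Definition vanishing : pred premero :=
  fun f => `[< exists W, [/\ open W, dense W & forall x, W x -> val f x = 0] >].

Lemma vanishing_idealr_closed : idealr_closed vanishing.
Proof.
split.
- apply/asboolP; exists setT; split => //; first exact: openT.
  by move=> W [x Wx] _; exists x.
- apply/negP => /asboolP[W [oW dW W0]].
  have [x [_ Wx]] := dW setT (ex_intro _ 0 I) openT.
  by have /eqP := W0 x Wx; rewrite oner_eq0.
- move=> a f g /asboolP[W [oW dW W0]] /asboolP[W' [oW' dW' W'0]].
  apply/asboolP; exists (W `&` W'); split; first exact: openI.
    move=> O [x Ox] oO; have [y [Oy Wy]] := dW O (ex_intro _ x Ox) oO.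
    have [z [[Oz Wz] W'z]] := dW' (O `&` W) (ex_intro _ y (conj Oy Wy))
      (openI oO oW).
    by exists z.
  move=> x [Wx W'x].
  change (val a x * val f x + val g x = 0).
  by rewrite W0// W'0// mulr0 addr0.
Qed.
HB.instance Definition _ := isIdealr.Build premero vanishing vanishing_idealr_closed.

(* Meromorphic functions, identified when they agree on a dense open set.  They
   form a field, but only the structure of commutative complex algebra is
   needed, so only that is registered. *)
Definition vanishing_idealr : idealr premero := vanishing.
Definition Mero : Type := {ideal_quot vanishing_idealr}.
HB.instance Definition _ := GRing.ComNzRing.on Mero.
Definition mero : premero -> Mero := \pi_{ideal_quot vanishing_idealr}.

Definition mero_cst (c : R[i]) : Mero :=
  mero (exist _ (fun=> c) (asboolT (is_mero_cst c))).

Lemma meroE (f g : premero) : val f = val g -> mero f = mero g.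
Proof. by move/val_inj->. Qed.

Lemma meroD f g : mero (f + g) = mero f + mero g.
Proof. exact: (raddfD \pi_{ideal_quot vanishing_idealr}). Qed.
Lemma meroM f g : mero (f * g) = mero f * mero g.
Proof. exact: (rmorphM \pi_{ideal_quot vanishing_idealr}). Qed.
Lemma mero1 : mero 1 = 1.
Proof. exact: (rmorph1 \pi_{ideal_quot vanishing_idealr}). Qed.

Lemma mero_cstD : {morph mero_cst : c d / c + d}.
Proof. by move=> c d; rewrite -meroD; exact: meroE. Qed.
Lemma mero_cstM : {morph mero_cst : c d / c * d}.
Proof. by move=> c d; rewrite -meroM; exact: meroE. Qed.
Lemma mero_cst1 : mero_cst 1 = 1.
Proof. by rewrite -mero1; exact: meroE. Qed.

Definition mero_scale (c : R[i]) (f : Mero) : Mero := mero_cst c * f.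

Lemma mero_scaleA c d f : mero_scale c (mero_scale d f) = mero_scale (c * d) f.
Proof. by rewrite /mero_scale mulrA mero_cstM. Qed.
Lemma mero_scale1 : left_id 1 mero_scale.
Proof. by move=> f; rewrite /mero_scale mero_cst1 mul1r. Qed.
Lemma mero_scaleDr : right_distributive mero_scale +%R.
Proof. by move=> c f g; rewrite /mero_scale mulrDr. Qed.
Lemma mero_scaleDl f : {morph mero_scale^~ f : c d / c + d}.
Proof. by move=> c d; rewrite /mero_scale mero_cstD mulrDl. Qed.
HB.instance Definition _ := GRing.Zmodule_isLmodule.Build R[i] Mero
  mero_scaleA mero_scale1 mero_scaleDr mero_scaleDl.

Lemma mero_scaleAl c (f g : Mero) : c *: (f * g) = (c *: f) * g.
Proof. exact: mulrA. Qed.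
HB.instance Definition _ := GRing.Lmodule_isLalgebra.Build R[i] Mero mero_scaleAl.
HB.instance Definition _ := GRing.Lalgebra_isComAlgebra.Build R[i] Mero.

Definition translate (a : dual h) (f : dual h -> R[i]) : dual h -> R[i] :=
  fun x => f (x + a).

Lemma of_coordsD x a : of_coords (x + coords a) = of_coords x + a.
Proof. by rewrite -[in RHS](coordsK a); exact: linearD. Qed.

Lemma coordsD x a : coords (x + a) = coords x + coords a.
Proof. exact: linearD. Qed.

Lemma open_translate (W : set (dual h)) a :
  open W -> open [set x | W (x + a)].
Proof.
move=> [B oB <-]; exists [set z | B (z + coords a)].
  apply: (@open_comp _ _ (fun z : coord_space => z + coords a)) => // x _.
  have := @cvgD _ _ _ (nbhs x) _ (fun z => z) (fun=> coords a) x (coords a).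
  by apply; [exact: cvg_id|exact: cvg_cst].
by apply/seteqP; split=> x; rewrite /preimage /= -coordsD.
Qed.

Lemma holomorphic_translate U f a : holomorphic_on U f ->
  holomorphic_on [set x | U (x + a)] (translate a f).
Proof.
move=> hf x Ux.
rewrite (_ : (fun z => _) = (fun z => f (of_coords z)) \o (fun z => z + coords a)).
  apply: differentiable_comp => /=; last by rewrite -coordsD; exact: hf.
  by apply: differentiableD.
by apply/funext => z; rewrite /translate /= of_coordsD.
Qed.

Lemma is_mero_translate a f : is_mero f -> is_mero (translate a f).
Proof.
move=> mf x.
have [U [p [q [[oU Ux] [hp hq] nq fE]]]] := mf (x + a).
exists [set x | U (x + a)], (translate a p), (translate a q); split.
- by split=> //; exact: open_translate.
- by split; exact: holomorphic_translate.
- move=> W oW sW [y Wy].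
  have [|||z Wz qz] := nq [set x | W (x - a)].
  + exact: open_translate.
  + by move=> z /sW /=; rewrite subrK.
  + by exists (y + a); rewrite /= addrK.
  + by exists (z - a); rewrite // /translate subrK.
- by move=> y Uy qy; exact: fE.
Qed.

Definition premero_translate a (f : premero) : premero :=
  exist _ (translate a (val f))
    (asboolT (is_mero_translate a (asboolW (valP f)))).

(* (T_a f)(x) = f (x + a) *)
Definition shift (a : dual h) (f : Mero) : Mero :=
  mero (premero_translate a (repr f)).

Lemma shift_mero a f : shift a (mero f) = mero (premero_translate a f).
Proof.
apply/eqP; rewrite -Quotient.idealrBE.
have : vanishing (repr (mero f) - f).
  have : repr (mero f) = f %[mod {ideal_quot vanishing_idealr}] by rewrite reprK.
  by move/eqP; rewrite -Quotient.idealrBE.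
move=> /asboolP[W [oW dW W0]]; apply/asboolP.
exists [set x | W (x + a)]; split.
- exact: open_translate.
- move=> V [y Vy] oV.
  have [|z [/= Vz Wz]] := dW [set x | V (x - a)] _ (open_translate (- a) oV).
    by exists (y + a); rewrite /= addrK.
  by exists (z - a); split => //; rewrite /= subrK.
- by move=> x /W0.
Qed.

Lemma meroP (f : Mero) : exists g, f = mero g.
Proof. by exists (repr f); rewrite /mero reprK. Qed.

Lemma shiftD a : {morph shift a : f g / f + g}.
Proof.
move=> f g; have [f' ->] := meroP f; have [g' ->] := meroP g.
by rewrite -meroD !shift_mero -meroD; exact: meroE.
Qed.

Lemma shiftM a : {morph shift a : f g / f * g}.
Proof.
move=> f g; have [f' ->] := meroP f; have [g' ->] := meroP g.
by rewrite -meroM !shift_mero -meroM; exact: meroE.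
Qed.

Lemma shift_cst a c : shift a (mero_cst c) = mero_cst c.
Proof. by rewrite shift_mero; exact: meroE. Qed.

Lemma shift1 a : shift a 1 = 1.
Proof. by rewrite -mero_cst1 shift_cst. Qed.

Lemma shift_linear a : linear (shift a).
Proof. by move=> c f g; rewrite shiftD [c *: f]/(mero_cst c * f) shiftM shift_cst. Qed.

Lemma shift0 f : shift 0 f = f.
Proof.
have [g ->] := meroP f; rewrite shift_mero; apply: meroE.
by apply/funext => x; rewrite /= /translate addr0.
Qed.

Lemma shift_shift a b f : shift a (shift b f) = shift (a + b) f.
Proof.
have [g ->] := meroP f; rewrite !shift_mero; apply: meroE.
by apply/funext => x; rewrite /= /translate addrA.
Qed.

End Dual.
Arguments shift_linear {R h} a.

Definition sums_of (V : zmodType) (P : set V) : set V :=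
  [set v | exists2 s : seq V, (forall x, x \in s -> P x) & v = \sum_(x <- s) x].

Section SumsOf.
Context (K : pzRingType) (V : lmodType K) (P : set V).

Lemma sums_of_sub : P `<=` sums_of P.
Proof.
move=> x Px; exists [:: x]; last by rewrite big_seq1.
by move=> y; rewrite inE => /eqP ->.
Qed.

Lemma sums_of0 : sums_of P 0.
Proof. by exists [::]; rewrite ?big_nil. Qed.

Lemma sums_ofD u v : sums_of P u -> sums_of P v -> sums_of P (u + v).
Proof.
move=> [s Ps ->] [t Pt ->]; exists (s ++ t); last by rewrite big_cat.
by move=> x; rewrite mem_cat => /orP[/Ps|/Pt].
Qed.

Lemma sums_of_big (I : Type) (s : seq I) (F : I -> V) :
  (forall i, sums_of P (F i)) -> sums_of P (\sum_(i <- s) F i).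
Proof.
by move=> PF; elim/big_ind: _ => // [|u v]; [exact: sums_of0|exact: sums_ofD].
Qed.

Lemma sums_of_ind (Q : set V) : Q 0 -> (forall u v, Q u -> Q v -> Q (u + v)) ->
  P `<=` Q -> sums_of P `<=` Q.
Proof.
move=> Q0 QD PQ v [s Ps ->]; rewrite big_seq.
by elim/big_ind: _ => // x /Ps /PQ.
Qed.

Lemma sums_of_submod :
  (forall c x, P x -> P (c *: x)) -> submod_closed [pred v | `[< sums_of P v >]].
Proof.
move=> PZ; split; first exact/asboolP/sums_of0.
move=> c u v /asboolP Pu /asboolP Pv; apply/asboolP; apply: sums_ofD => //.
apply: (sums_of_ind (Q := [set x | sums_of P (c *: x)])) Pu => [|x y|x Px] /=;
  rewrite ?scaler0 ?scalerDr.
- exact: sums_of0.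
- exact: sums_ofD.
- exact/sums_of_sub/PZ.
Qed.
End SumsOf.

Definition direct_sum (K : pzRingType) (V : lmodType K) (I : eqType)
    (W : I -> set V) : Prop :=
  [/\ forall i, W i 0 /\ forall c u v, W i u -> W i v -> W i (c *: u + v),
      forall v, exists (s : seq I) (w : I -> V),
        [/\ uniq s, forall i, W i (w i) & v = \sum_(i <- s) w i]
    & forall (s : seq I) (w : I -> V), uniq s -> (forall i, W i (w i)) ->
        \sum_(i <- s) w i = 0 -> forall i, i \in s -> w i = 0].

Lemma direct_sum_lift (K : pzRingType) (V V' : lmodType K) (I : eqType)
    (W : I -> set V) (g : I -> V -> V') : direct_sum W ->
  (forall i, linear (g i)) ->
  exists2 u : V -> V', linear u & forall i v, W i v -> u v = g i v.
Proof.
move=> [W0 Wspan Wind] glin.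
have g0 i : g i 0 = 0.
  by have := glin i (-1) 0 0; rewrite scaler0 addr0 scaleN1r addNr.
have gD i v w : g i (v + w) = g i v + g i w.
  by have := glin i 1 v w; rewrite !scale1r.
have gN i v : g i (- v) = - g i v.
  by have := glin i (-1) v 0; rewrite !scaleN1r addr0 g0 addr0.
pose ext (s : seq I) (w : I -> V) i := if i \in s then w i else 0.
have extW s w : (forall i, W i (w i)) -> forall i, W i (ext s w i).
  by move=> Ww i; rewrite /ext; case: ifP => // _; case: (W0 i).
have sum_ext (A : zmodType) (s t : seq I) (F : I -> A) : uniq s -> uniq t ->
    {subset s <= t} ->
    \sum_(i <- t) (if i \in s then F i else 0) = \sum_(i <- s) F i.
  move=> us ut st; rewrite -big_mkcond /= -big_filter; apply: perm_big.
  apply: uniq_perm => [||i]; rewrite ?filter_uniq// mem_filter.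
  by apply: andb_idr; exact: st.
have key s w s' w' : uniq s -> uniq s' -> (forall i, W i (w i)) ->
    (forall i, W i (w' i)) -> \sum_(i <- s) w i = \sum_(i <- s') w' i ->
    \sum_(i <- s) g i (w i) = \sum_(i <- s') g i (w' i).
  move=> us us' Ww Ww' E.
  pose t := undup (s ++ s'); have ut : uniq t by exact: undup_uniq.
  have st : {subset s <= t} by move=> i; rewrite mem_undup mem_cat => ->.
  have st' : {subset s' <= t} by move=> i; rewrite mem_undup mem_cat orbC => ->.
  have z i : i \in t -> ext s w i - ext s' w' i = 0.
    move=> it; apply: (Wind t (fun i => ext s w i - ext s' w' i) ut _ _ i it).
    - move=> j; rewrite addrC -scaleN1r; have [_] := W0 j; apply; exact: extW.
    - by rewrite sumrB !sum_ext// E subrr.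
  have E1 : \sum_(i <- t) g i (ext s w i) = \sum_(i <- t) g i (ext s' w' i).
    by rewrite !big_seq; apply: eq_bigr => i /z /eqP; rewrite subr_eq0 => /eqP->.
  rewrite -(sum_ext _ s t)// -(sum_ext _ s' t)//.
  have gext r x : \sum_(i <- t) (if i \in r then g i (x i) else 0) =
      \sum_(i <- t) g i (ext r x i).
    by apply: eq_bigr => i _; rewrite /ext; case: ifP.
  by rewrite !gext.
pose graph v y := exists s w, [/\ uniq s, forall i, W i (w i),
  v = \sum_(i <- s) w i & y = \sum_(i <- s) g i (w i)].
have graph_ex v : exists y, graph v y.
  have [s [w [us Ww ->]]] := Wspan v.
  by exists (\sum_(i <- s) g i (w i)), s, w.
have graph_fun v y y' : graph v y -> graph v y' -> y = y'.
  move=> [s [w [us Ww vE ->]]] [s' [w' [us' Ww' vE' ->]]].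
  by apply: key => //; rewrite -vE.
pose u v := projT1 (cid (graph_ex v)).
have uP v : graph v (u v) by rewrite /u; case: cid.
exists u.
- move=> c v v'; apply: (graph_fun _ _ _ (uP _)).
  have [s [w [us Ww vE uE]]] := uP v; have [s' [w' [us' Ww' vE' uE']]] := uP v'.
  pose t := undup (s ++ s'); have ut : uniq t by exact: undup_uniq.
  have st : {subset s <= t} by move=> i; rewrite mem_undup mem_cat => ->.
  have st' : {subset s' <= t} by move=> i; rewrite mem_undup mem_cat orbC => ->.
  exists t, (fun i => c *: ext s w i + ext s' w' i); split=> //.
  + by move=> i; have [_] := W0 i; apply; exact: extW.
  + by rewrite big_split /= -scaler_sumr !sum_ext// -vE -vE'.
  + under eq_bigr do rewrite glin.
    rewrite big_split /= -scaler_sumr uE uE' -(sum_ext _ s t)// -(sum_ext _ s' t)//.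
    by congr (_ *: _ + _); apply: eq_bigr => i _; rewrite /ext; case: ifP.
- move=> i v Wv; apply: (graph_fun _ _ _ (uP _)).
  exists [:: i], (fun j => if j == i then v else 0); split=> //.
  + by move=> j; case: eqP => [->//|_]; case: (W0 j).
  + by rewrite big_seq1 eqxx.
  + by rewrite big_seq1 eqxx.
Qed.

(* One side of a balanced tensor product: a graded complex vector space with an
   action of [Mero h].  [gr_comp i g] is the component of outer degree i and
   inner degree g: inner degrees have to match in a tensor product, and the
   action is the one that is balanced. *)
Record graded (R : realType) (h : vectType R[i]) (I : choiceType) := Graded {
  gr_sort :> lmodType R[i];
  gr_comp : I -> dual h -> set gr_sort;
  gr_act : Mero h -> gr_sort -> gr_sort }.

Section Tensor.
Context (R : realType) (h : vectType R[i]) (I K : choiceType).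
Context (E : graded h I) (F : graded h K).

(* Generators of the direct sum over (i, g, k) of the spaces
   E_{i,g} (x) F_{k,g}. *)
Definition matching (x : I * dual h * K * E * F) : Prop :=
  let: (i, g, k, e, f) := x in gr_comp i g e /\ gr_comp k g f.

Definition generator := {x : I * dual h * K * E * F | `[< matching x >]}.
HB.instance Definition _ := SubType.on generator.
HB.instance Definition _ := Choice.on generator.

Definition formal := {freeg generator / R[i]}.
HB.instance Definition _ := GRing.Lmodule.on formal.

Definition formal_tensor i g k e f : formal :=
  if insub (i, g, k, e, f) is Some x then << (x : generator) >> else 0.

Inductive tensor_rel : set formal :=
| TensorDl i g k e e' f of gr_comp i g e & gr_comp i g e' & gr_comp k g f :
    tensor_rel (formal_tensor i g k (e + e') f
                - (formal_tensor i g k e f + formal_tensor i g k e' f))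
| TensorDr i g k e f f' of gr_comp i g e & gr_comp k g f & gr_comp k g f' :
    tensor_rel (formal_tensor i g k e (f + f')
                - (formal_tensor i g k e f + formal_tensor i g k e f'))
| TensorZl i g k c e f of gr_comp i g e & gr_comp k g f :
    tensor_rel (formal_tensor i g k (c *: e) f - c *: formal_tensor i g k e f)
| TensorZr i g k c e f of gr_comp i g e & gr_comp k g f :
    tensor_rel (formal_tensor i g k e (c *: f) - c *: formal_tensor i g k e f)
| TensorM i g k m e f of gr_comp i g e & gr_comp k g f :
    tensor_rel (formal_tensor i g k (gr_act m e) f
                - formal_tensor i g k e (gr_act m f)).

Definition tensor_relZ : set formal :=
  [set x | exists c y, tensor_rel y /\ x = c *: y].

Definition tensor_ker : pred formal := [pred x | `[< sums_of tensor_relZ x >]].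

Lemma tensor_ker_submod : submod_closed tensor_ker.
Proof.
by apply: sums_of_submod => c x [d [y [ry ->]]]; exists (c * d), y; rewrite scalerA.
Qed.
HB.instance Definition _ := GRing.isZmodClosed.Build formal tensor_ker
  (GRing.submod_closedB tensor_ker_submod).

Definition tensor_ker_submodule : zmodClosed formal :=
  Algebra.ZmodClosed.clone formal tensor_ker _.
Definition tensor : Type := {ideal_quot tensor_ker_submodule}.
HB.instance Definition _ := GRing.Zmodule.on tensor.

Definition tensor_pi : formal -> tensor := \pi_{ideal_quot tensor_ker_submodule}.

Lemma tensor_piP x y : reflect (tensor_pi x = tensor_pi y) (tensor_ker (x - y)).
Proof. by rewrite -[tensor_ker _]/(x - y \in tensor_ker_submodule) Quotient.idealrBE; exact: eqP. Qed.

Definition tensor_scale (c : R[i]) (t : tensor) : tensor := tensor_pi (c *: repr t).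

Lemma tensor_scale_pi c x : tensor_scale c (tensor_pi x) = tensor_pi (c *: x).
Proof.
apply/tensor_piP; rewrite -scalerBr.
have : tensor_ker (repr (tensor_pi x) - x).
  by apply/tensor_piP; rewrite /tensor_pi reprK.
exact: (GRing.subsemimod_closedZ (GRing.submod_closed_semi tensor_ker_submod)).
Qed.

Lemma tensor_piD x y : tensor_pi (x + y) = tensor_pi x + tensor_pi y.
Proof. exact: (raddfD \pi_{ideal_quot tensor_ker_submodule}). Qed.

Lemma tensor_reprK t : tensor_pi (repr t) = t.
Proof. exact: reprK. Qed.

Lemma tensor_scaleA c d t :
  tensor_scale c (tensor_scale d t) = tensor_scale (c * d) t.
Proof. by rewrite -(tensor_reprK t) !tensor_scale_pi scalerA. Qed.
Lemma tensor_scale1 : left_id 1 tensor_scale.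
Proof. by move=> t; rewrite -(tensor_reprK t) !tensor_scale_pi scale1r. Qed.
Lemma tensor_scaleDr : right_distributive tensor_scale +%R.
Proof.
move=> c t u; rewrite -(tensor_reprK t) -(tensor_reprK u) -tensor_piD.
by rewrite !tensor_scale_pi scalerDr tensor_piD.
Qed.
Lemma tensor_scaleDl t : {morph tensor_scale^~ t : c d / c + d}.
Proof.
by move=> c d; rewrite -(tensor_reprK t) !tensor_scale_pi scalerDl tensor_piD.
Qed.
HB.instance Definition _ := GRing.Zmodule_isLmodule.Build R[i] tensor
  tensor_scaleA tensor_scale1 tensor_scaleDr tensor_scaleDl.

Definition pure i g k (e : E) (f : F) : tensor :=
  tensor_pi (formal_tensor i g k e f).

Definition tensor_comp (i : I) (k : K) : set tensor :=
  sums_of [set t | exists g e f,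
    [/\ gr_comp i g e, gr_comp k g f & t = pure i g k e f]].

Section Lift.
Context (G : lmodType R[i]) (phi : I -> dual h -> K -> E -> F -> G).

Definition formal_lift : formal -> G :=
  fglift (fun x : generator => let: (i, g, k, e, f) := val x in phi i g k e f).

Lemma formal_liftB x y : formal_lift (x - y) = formal_lift x - formal_lift y.
Proof. exact: lift_is_additive. Qed.

Lemma formal_lift0 : formal_lift 0 = 0.
Proof. by rewrite -(subrr 0) formal_liftB subrr. Qed.

Lemma formal_liftD x y : formal_lift (x + y) = formal_lift x + formal_lift y.
Proof.
by rewrite -{1}(opprK y) formal_liftB -(sub0r y) formal_liftB formal_lift0 sub0r opprK.
Qed.

Lemma formal_liftZ c x : formal_lift (c *: x) = c *: formal_lift x.
Proof.
suff : forall s : seq generator,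
    formal_lift (c *: \sum_(z <- s) << coeff z x *g z >>) =
    c *: formal_lift (\sum_(z <- s) << coeff z x *g z >>).
  by move=> /(_ (dom x)); rewrite freeg_sumE.
move=> s; rewrite scaler_sumr.
have lift_sum (r : seq generator) (a : generator -> formal) :
    formal_lift (\sum_(z <- r) a z) = \sum_(z <- r) formal_lift (a z).
  by elim/big_ind2: _ => [|? ? ? ? <- <-|//]; rewrite ?formal_lift0// formal_liftD.
rewrite !lift_sum scaler_sumr; apply: eq_bigr => z _.
have -> : c *: << coeff z x *g z >> = << c * coeff z x *g z >> :> formal.
  by apply/eqP/freeg_eqP => y; rewrite coeffZ !coeffU mulrA.
by rewrite /formal_lift !liftU scalerA.
Qed.

Lemma formal_lift_tensor i g k e f : gr_comp i g e -> gr_comp k g f ->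
  formal_lift (formal_tensor i g k e f) = phi i g k e f.
Proof.
move=> Ee Ff; rewrite /formal_tensor.
case: insubP => [x _ xE|/asboolP[]//].
by rewrite /formal_lift liftU scale1r xE.
Qed.

Definition balanced : Prop := forall i g k,
  [/\ forall e e' f, gr_comp i g e -> gr_comp i g e' -> gr_comp k g f ->
        phi i g k (e + e') f = phi i g k e f + phi i g k e' f,
      forall e f f', gr_comp i g e -> gr_comp k g f -> gr_comp k g f' ->
        phi i g k e (f + f') = phi i g k e f + phi i g k e f',
      forall c e f, gr_comp i g e -> gr_comp k g f ->
        phi i g k (c *: e) f = c *: phi i g k e f /\
        phi i g k e (c *: f) = c *: phi i g k e f
    & forall m e f, gr_comp i g e -> gr_comp k g f ->
        phi i g k (gr_act m e) f = phi i g k e (gr_act m f)].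

(* The linear map sending the class of e (x) f, for e in E_{i,g} and f in
   F_{k,g}, to phi i g k e f; this is meaningful for balanced phi. *)
Definition tensor_lift (t : tensor) : G := formal_lift (repr t).
End Lift.
End Tensor.

Arguments pure {R h I K E F} i g k e f.
Arguments tensor_comp {R h I K E F} i k.
Arguments tensor_lift {R h I K E F G} phi t.

Definition graded_closed (R : realType) (h : vectType R[i]) (I : choiceType)
    (E : graded h I) : Prop :=
  forall i g, [/\ forall e e', gr_comp i g e -> gr_comp i g e' ->
                    @gr_comp _ _ _ E i g (e + e'),
                  forall c e, gr_comp i g e -> @gr_comp _ _ _ E i g (c *: e)
                & forall m e, gr_comp i g e -> @gr_comp _ _ _ E i g (gr_act m e)].

Section TensorLift.
Context (R : realType) (h : vectType R[i]) (I K : choiceType).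
Context (E : graded h I) (F : graded h K) (G : lmodType R[i]).
Context (phi : I -> dual h -> K -> E -> F -> G).
Context (cE : graded_closed E) (cF : graded_closed F) (bphi : balanced phi).

Lemma formal_lift_ker x : tensor_ker x -> formal_lift phi x = 0.
Proof.
move=> /asboolP; apply: (@sums_of_ind _ _ _ [set x | formal_lift phi x = 0]).
- exact: formal_lift0.
- by move=> u v /= u0 v0; rewrite formal_liftD u0 v0 addr0.
move=> _ [c [y [ry ->]]] /=; rewrite formal_liftZ.
suff -> : formal_lift phi y = 0 by rewrite scaler0.
case: ry => [i g k e e' f Ee Ee' Ff|i g k e f f' Ee Ff Ff'|i g k a e f Ee Ff
  |i g k a e f Ee Ff|i g k m e f Ee Ff];
  have [ED EZ EM] := cE i g; have [FD FZ FM] := cF k g;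
  have [phiDl phiDr phiZ phiM] := bphi i g k;
  rewrite formal_liftB ?formal_liftD ?formal_liftZ !formal_lift_tensor //;
  by [exact: ED|exact: EZ|exact: EM|exact: FD|exact: FZ|exact: FM|
      rewrite (phiDl, phiDr)// subrr|have [-> _] := phiZ a e f Ee Ff; rewrite subrr
      |have [_ ->] := phiZ a e f Ee Ff; rewrite subrr|rewrite phiM// subrr].
Qed.

Lemma tensor_lift_pi x : tensor_lift phi (tensor_pi x) = formal_lift phi x.
Proof.
apply/eqP; rewrite -subr_eq0 /tensor_lift -formal_liftB; apply/eqP.
by apply: formal_lift_ker; apply/tensor_piP; rewrite tensor_reprK.
Qed.

Lemma tensor_lift_linear : linear (tensor_lift phi).
Proof.
move=> c t u; rewrite -(tensor_reprK t) -(tensor_reprK u).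
rewrite [c *: _]tensor_scale_pi -tensor_piD !tensor_lift_pi.
by rewrite formal_liftD formal_liftZ.
Qed.

Lemma tensor_lift_pure i g k e f : gr_comp i g e -> gr_comp k g f ->
  tensor_lift phi (pure i g k e f) = phi i g k e f.
Proof. by move=> Ee Ff; rewrite tensor_lift_pi formal_lift_tensor. Qed.
End TensorLift.

Record bigraded (R : realType) (h : vectType R[i]) := Bigraded {
  bg_sort :> lmodType R[i];
  bg_comp : dual h -> dual h -> set bg_sort;
  bg_mul : Mero h -> bg_sort -> bg_sort;
  bg_mur : Mero h -> bg_sort -> bg_sort }.

Section Prealgebras.
Context (R : realType) (h : vectType R[i]).
Implicit Types (A B : bigraded h).

(* An action of the complex algebra [Mero h] on a complex vector space. *)
Definition is_action (V : lmodType R[i]) (act : Mero h -> V -> V) : Prop :=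
  [/\ forall f, linear (act f),
      forall c v, act (mero_cst h c) v = c *: v,
      forall f g v, act (f + g) v = act f v + act g v
    & forall f g v, act (f * g) v = act f (act g v)].

Definition is_prealgebra A : Prop :=
  [/\ direct_sum (fun ab : dual h * dual h => @bg_comp _ _ A ab.1 ab.2),
      is_action (@bg_mul _ _ A) /\ is_action (@bg_mur _ _ A),
      forall f g (x : A), bg_mul f (bg_mur g x) = bg_mur g (bg_mul f x)
    & forall a b f (x : A), bg_comp a b x ->
        bg_comp a b (bg_mul f x) /\ bg_comp a b (bg_mur f x)].

Definition is_prealgebra_hom A B (phi : A -> B) : Prop :=
  [/\ linear phi,
      forall a b x, bg_comp a b x -> bg_comp a b (phi x),
      forall f x, phi (bg_mul f x) = bg_mul f (phi x)
    & forall f x, phi (bg_mur f x) = bg_mur f (phi x)].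

(* A as the left, resp. right, factor of a tensor product. *)
Definition as_left A : graded h (dual h) :=
  Graded (@bg_comp _ _ A) (@bg_mur _ _ A).
Definition as_right A : graded h (dual h) :=
  Graded (fun k g => @bg_comp _ _ A g k) (@bg_mul _ _ A).

(* phi (x) psi, where phi and psi preserve inner degrees and change outer
   degrees by a and b. *)
Definition tensor_map (I K I' K' : choiceType)
    (E : graded h I) (F : graded h K) (E' : graded h I') (F' : graded h K')
    (a : I -> I') (b : K -> K') (phi : E -> E') (psi : F -> F') :
    tensor E F -> tensor E' F' :=
  tensor_lift (fun i g k e f => pure (a i) g (b k) (phi e) (psi f)).

Arguments tensor_map {I K I' K'} E F E' F' a b phi psi.

(* E (x) A with the action of [Mero h] through mu_r, and A (x) F with the action
   through mu_l: as graded spaces these are left, resp. right, factors of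
   further tensor products. *)
Definition tensorR (I : choiceType) (E : graded h I) A : graded h I :=
  @Graded _ _ _ (tensor E (as_right A)) (fun i k => tensor_comp i k)
    (fun f => tensor_map E (as_right A) E (as_right A) id id id (@bg_mur _ _ A f)).

Definition tensorL (K : choiceType) A (F : graded h K) : graded h K :=
  @Graded _ _ _ (tensor (as_left A) F) (fun k i => tensor_comp i k)
    (fun f => tensor_map (as_left A) F (as_left A) F id id (@bg_mul _ _ A f) id).

Definition tensor_bg A B : bigraded h :=
  @Bigraded _ _ (tensor (as_left A) (as_right B)) (fun i k => tensor_comp i k)
    (@gr_act _ _ _ (tensorL A (as_right B)))
    (@gr_act _ _ _ (tensorR (as_left A) B)).

(* The associativity isomorphism (e (x) x) (x) f |-> e (x) (x (x) f). *)
Definition tensor_assoc (I K : choiceType) (E : graded h I) A (F : graded h K) :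
    tensor (tensorR E A) F -> tensor E (tensorL A F) :=
  tensor_lift (fun i b k (t : tensorR E A) (f : F) =>
    tensor_lift (fun i' g b' (e : E) (x : as_right A) =>
      if (i' == i) && (b' == b) then
        pure i g k e (pure g b k (x : as_left A) f : tensorL A F)
      else 0) t).

Arguments tensor_assoc {I K} E A F _.

Definition dop_fun (f : Mero h) (a : dual h) : Mero h -> Mero h :=
  fun u => f * shift a u.

(* Finite sums of operators f T_a *)
Definition is_diffop : set (Mero h -> Mero h) :=
  sums_of [set P | exists f a, P = dop_fun f a].

Definition is_diffopb : pred (Mero h -> Mero h) := [pred P | `[< is_diffop P >]].

Lemma is_diffop_submod : submod_closed is_diffopb.
Proof.
apply: sums_of_submod => c _ [f [a ->]]; exists (c *: f), a.
by apply/funext => u; rewrite /dop_fun -scalerAl.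
Qed.
HB.instance Definition _ := GRing.isSubmodClosed.Build R[i]
  (Mero h -> Mero h) is_diffopb is_diffop_submod.

Definition diffop : Type := {P : Mero h -> Mero h | is_diffopb P}.
HB.instance Definition _ := SubType.on diffop.
HB.instance Definition _ := Choice.on diffop.
HB.instance Definition _ := [SubChoice_isSubLmodule of diffop by <:].

Lemma is_diffop_term f a : is_diffopb (dop_fun f a).
Proof. by apply/asboolP/sums_of_sub; exists f, a. Qed.

Definition dop f a : diffop := exist _ (dop_fun f a) (is_diffop_term f a).

Lemma is_diffop_comp P Q : is_diffop P -> is_diffop Q -> is_diffop (P \o Q).
Proof.
move=> dP dQ; refine (@sums_of_ind R[i] (Mero h -> Mero h) _
  [set P : Mero h -> Mero h | is_diffop (P \o Q)] _ _ _ P dP).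
- exact: sums_of0.
- by move=> u v; exact: sums_ofD.
move=> _ [f [a ->]] /=.
refine (@sums_of_ind R[i] (Mero h -> Mero h) _
  [set Q : Mero h -> Mero h | is_diffop (dop_fun f a \o Q)] _ _ _ Q dQ).
- rewrite /= (_ : _ \o _ = 0); first exact: sums_of0.
  apply/funext => u; rewrite /dop_fun /= [shift _ _](_ : _ = 0) ?mulr0//.
  by have := shift_linear a (-1) 0 0; rewrite !scaleN1r !addNr.
- move=> u v /= du dv; rewrite (_ : _ \o _ = (dop_fun f a \o u) + (dop_fun f a \o v)).
    exact: sums_ofD.
  by apply/funext => x; rewrite /dop_fun /= shiftD mulrDr.
- move=> _ [g [b ->]] /=; apply: sums_of_sub; exists (f * shift a g), (a + b).
  by apply/funext => u; rewrite /dop_fun /= shiftM shift_shift mulrA.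
Qed.

Definition dop_mul (P Q : diffop) : diffop :=
  exist _ (val P \o val Q)
    (asboolT (is_diffop_comp (asboolW (valP P)) (asboolW (valP Q)))).

Definition dop_comp (a b : dual h) : set diffop :=
  [set P | if a == b then exists f, P = dop f (- a) else P = 0].

Definition diffop_bg : bigraded h :=
  @Bigraded _ _ diffop dop_comp
    (fun f => dop_mul (dop f 0)) (fun f => dop_mul (dop f 0)).

(* f T_{-a} (x) x |-> mu_l(f) x  and  x (x) f T_{-b} |-> mu_r(f) x, where f is
   recovered as f T_{-a} 1. *)
Definition tensor_unitl (K : choiceType) (F : graded h K) :
    tensor (as_left diffop_bg) F -> F :=
  tensor_lift (fun _ _ _ (P : as_left diffop_bg) (x : F) =>
    gr_act (val (P : diffop) 1) x).
Definition tensor_unitr (I : choiceType) (E : graded h I) :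
    tensor E (as_right diffop_bg) -> E :=
  tensor_lift (fun _ _ _ (x : E) (P : as_right diffop_bg) =>
    gr_act (val (P : diffop) 1) x).

Record coalgebroid_on A := CoalgebroidOn {
  Delta : A -> tensor_bg A A;
  counit : A -> diffop_bg;
  Delta_hom : is_prealgebra_hom Delta;
  counit_hom : is_prealgebra_hom counit;
  Delta_coassoc : forall x,
    tensor_assoc (as_left A) A (as_right A)
      (tensor_map (as_left A) (as_right A)
         (as_left (tensor_bg A A)) (as_right A) id id Delta id (Delta x)) =
    tensor_map (as_left A) (as_right A)
      (as_left A) (as_right (tensor_bg A A)) id id id Delta (Delta x);
  counit_left : forall x,
    tensor_unitl (tensor_map (as_left A) (as_right A)
      (as_left diffop_bg) (as_right A) id id counit id (Delta x)) = x;
  counit_right : forall x,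
    tensor_unitr (tensor_map (as_left A) (as_right A)
      (as_left A) (as_right diffop_bg) id id id counit (Delta x)) = x }.

End Prealgebras.

Arguments tensor_map {R h I K I' K'} E F E' F' a b phi psi _.
Arguments tensor_assoc {R h I K} E A F _.
Arguments dop {R h} f a.
Arguments dop_mul {R h} P Q.
Arguments diffop {R} h.
Arguments diffop_bg {R} h.

(* The operations of an h-algebra, without axioms. *)
Record halgebra_data (R : realType) (h : vectType R[i]) := HalgebraData {
  hd_sort :> lmodType R[i];
  hd_times : hd_sort -> hd_sort -> hd_sort;
  hd_one : hd_sort;
  hd_comp : dual h -> dual h -> set hd_sort;
  hd_mul : Mero h -> hd_sort;
  hd_mur : Mero h -> hd_sort }.

Section HalgebraData.
Context (R : realType) (h : vectType R[i]).
Implicit Types (A B : halgebra_data h).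

Definition bigraded_of A : bigraded h :=
  @Bigraded _ _ A (@hd_comp _ _ A)
    (fun f => hd_times (hd_mul A f)) (fun f => hd_times (hd_mur A f)).

Definition is_halgebra_hom A B (phi : A -> B) : Prop :=
  [/\ linear phi,
      (forall x y, phi (hd_times x y) = hd_times (phi x) (phi y)) /\
      phi (hd_one A) = hd_one B,
      forall a b x, hd_comp a b x -> hd_comp a b (phi x)
    & forall f, phi (hd_mul A f) = hd_mul B f /\ phi (hd_mur A f) = hd_mur B f].

Definition lr_halgebra A : halgebra_data h :=
  @HalgebraData _ _ A (@hd_times _ _ A) (hd_one A)
    (fun a b => @hd_comp _ _ A b a) (hd_mur A) (hd_mul A).

Definition opp_halgebra A : halgebra_data h :=
  @HalgebraData _ _ A (fun x y => hd_times y x) (hd_one A)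
    (fun a b => @hd_comp _ _ A (- a) (- b)) (hd_mul A) (hd_mur A).

Definition diffop_halgebra : halgebra_data h :=
  @HalgebraData _ _ (diffop h) dop_mul (dop 1 0) (@dop_comp _ h)
    (fun f => dop f 0) (fun f => dop f 0).

(* The componentwise product (x (x) y) (x' (x) y') = x x' (x) y y' *)
Definition tensor_halgebra A B : halgebra_data h :=
  let E := as_left (bigraded_of A) in
  let F := as_right (bigraded_of B) in
  @HalgebraData _ _ (tensor E F)
    (fun t u => tensor_lift (fun i g k (x : E) (y : F) =>
       tensor_lift (fun i' g' k' (x' : E) (y' : F) =>
         @pure _ _ _ _ E F (i + i') (g + g') (k + k')
           (@hd_times _ _ A x x') (@hd_times _ _ B y y')) u) t)
    (@pure _ _ _ _ E F 0 0 0 (hd_one A) (hd_one B))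
    (fun i k => tensor_comp i k)
    (fun f => @pure _ _ _ _ E F 0 0 0 (hd_mul A f) (hd_one B))
    (fun f => @pure _ _ _ _ E F 0 0 0 (hd_one A) (hd_mur B f)).
End HalgebraData.

(* That the moment maps are morphisms of complex algebras is part of
   [is_prealgebra]. *)
Record halgebra (R : realType) (h : vectType R[i]) := Halgebra {
  ha_sort :> algType R[i];
  ha_comp : dual h -> dual h -> set ha_sort;
  ha_mul : Mero h -> ha_sort;
  ha_mur : Mero h -> ha_sort;
  ha_data : halgebra_data h :=
    @HalgebraData _ _ ha_sort (fun x y => x * y) 1 ha_comp ha_mul ha_mur;
  ha_prealgebra : is_prealgebra (bigraded_of ha_data);
  ha_one : ha_comp 0 0 1;
  ha_times : forall a b c d x y,
    ha_comp a b x -> ha_comp c d y -> ha_comp (a + c) (b + d) (x * y);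
  ha_moment00 : forall f, ha_comp 0 0 (ha_mul f) /\ ha_comp 0 0 (ha_mur f);
  ha_mul_inj : injective ha_mul;
  ha_mur_inj : injective ha_mur;
  ha_moment : forall a b f x, ha_comp a b x ->
    ha_mul f * x = x * ha_mul (shift a f) /\
    ha_mur f * x = x * ha_mur (shift b f) }.

Definition ha_bg (R : realType) (h : vectType R[i]) (U : halgebra h) :
  bigraded h := bigraded_of (ha_data U).

Record coalgebroid (R : realType) (h : vectType R[i]) := Coalgebroid {
  co_bg :> bigraded h;
  co_prealgebra : is_prealgebra co_bg;
  co_struct :> coalgebroid_on co_bg }.

(* [hopf_Delta] and [hopf_counit] say that U is an h-bialgebroid.  The
   antimultiplicativity of the antipode and its behaviour on degrees and moment
   maps are consequences of these axioms. *)
Record hopf_algebroid (R : realType) (h : vectType R[i]) (U : halgebra h) :=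
  HopfAlgebroid {
  hopf_co :> coalgebroid_on (ha_bg U);
  hopf_Delta : @is_halgebra_hom _ _ (ha_data U)
    (tensor_halgebra (ha_data U) (ha_data U)) (Delta hopf_co);
  hopf_counit : @is_halgebra_hom _ _ (ha_data U)
    (diffop_halgebra h) (counit hopf_co);
  antipode : U -> U;
  antipode_linear : linear antipode;
  antipode_mur : forall f x,
    antipode (ha_mur U f * x) = antipode x * ha_mul U f;
  antipode_mul : forall f x,
    antipode (x * ha_mul U f) = ha_mur U f * antipode x;
  antipode_right : forall x,
    tensor_lift (fun _ _ _ (y : as_left (ha_bg U)) (z : as_right (ha_bg U)) =>
      (y : U) * antipode z) (Delta hopf_co x) =
    ha_mul U (val (counit hopf_co x : diffop h) 1);
  antipode_left : forall a b x, ha_comp a b x ->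
    tensor_lift (fun _ _ _ (y : as_left (ha_bg U)) (z : as_right (ha_bg U)) =>
      antipode y * (z : U)) (Delta hopf_co x) =
    ha_mur U (shift a (val (counit hopf_co x : diffop h) 1)) }.

Record pairing (R : realType) (h : vectType R[i]) (U : halgebra h)
    (A : coalgebroid h) := Pairing {
  pr :> U -> A -> diffop h;
  pr_linearl : forall x, linear (fun X => pr X x);
  pr_linearr : forall X, linear (pr X);
  pr_comp : forall a b c d X x, ha_comp a b X -> bg_comp c d x ->
    dop_comp (a + d) (b + c) (pr X x);
  pr_mull : forall f X x, pr (ha_mul U f * X) x = dop_mul (dop f 0) (pr X x);
  pr_mulr : forall f X x, pr X (bg_mul f x) = dop_mul (dop f 0) (pr X x);
  pr_murl : forall f X x, pr (X * ha_mur U f) x = dop_mul (pr X x) (dop f 0);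
  pr_murr : forall f X c d x, bg_comp c d x ->
    pr X (bg_mur (shift (- d) f) x) = dop_mul (pr X x) (dop f 0);
  pr_times : forall X Y x,
    pr (X * Y) x =
    tensor_lift (fun _ g _ (y : as_left A) (z : as_right A) =>
      dop_mul (dop_mul (pr X y) (dop 1 g)) (pr Y z)) (Delta A x);
  pr_one : forall x, pr 1 x = counit A x }.

(* A diagonalisable action of h is recorded by its weight spaces: x in h acts
   on the weight space of a as the scalar a x. *)
Record hspace (R : realType) (h : vectType R[i]) := Hspace {
  hs_sort :> lmodType (Mero h);
  hs_wt : dual h -> set hs_sort;
  hs_axiom : direct_sum hs_wt }.

(* Restriction of scalars to the constants *)
Definition restr (R : realType) (h : vectType R[i]) (V : hspace h) : Type := V.

Section Restr.
Context (R : realType) (h : vectType R[i]) (V : hspace h).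
HB.instance Definition _ := GRing.Zmodule.on (restr V).

Definition restr_scale (c : R[i]) (v : restr V) : restr V :=
  mero_cst h c *: (v : V).

Lemma restr_scaleA c d v : restr_scale c (restr_scale d v) = restr_scale (c * d) v.
Proof. by rewrite /restr_scale scalerA mero_cstM. Qed.
Lemma restr_scale1 : left_id 1 restr_scale.
Proof. by move=> v; rewrite /restr_scale mero_cst1 scale1r. Qed.
Lemma restr_scaleDr : right_distributive restr_scale +%R.
Proof. by move=> c u v; rewrite /restr_scale scalerDr. Qed.
Lemma restr_scaleDl v : {morph restr_scale^~ v : c d / c + d}.
Proof. by move=> c d; rewrite /restr_scale mero_cstD scalerDl. Qed.
HB.instance Definition _ := GRing.Zmodule_isLmodule.Build R[i] (restr V)
  restr_scaleA restr_scale1 restr_scaleDr restr_scaleDl.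

Definition hs_act (f : Mero h) (v : restr V) : restr V := f *: (v : V).

Definition graded_of : graded h unit :=
  @Graded _ _ _ (restr V) (fun _ => @hs_wt _ _ V) hs_act.

(* The component of degree (a, b) of D_{h^*,V} *)
Definition is_dopV (a b : dual h) : set (restr V -> restr V) :=
  [set U | [/\ linear U, forall f v, U (hs_act f v) = hs_act (shift (- b) f) (U v)
    & forall c v, hs_wt c v -> hs_wt (c - a + b) (U v)]].

(* D_{h^*,V} is realised inside the space of all maps V -> V: the sum of its
   components there is direct, because distinct shifts of the field [Mero h] are
   linearly independent over it. *)
Definition is_opV : set (restr V -> restr V) :=
  sums_of [set U | exists a b, is_dopV a b U].
Definition is_opVb : pred (restr V -> restr V) := [pred U | `[< is_opV U >]].

Lemma hs_wtZ c (f : Mero h) (v : V) : hs_wt c v -> hs_wt c (f *: v).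
Proof.
have [/(_ c)[w0 wD] _ _] := hs_axiom V.
by move=> wv; rewrite -[f *: v]addr0; exact: wD.
Qed.

Lemma hs_actC f g v : hs_act f (hs_act g v) = hs_act g (hs_act f v).
Proof. by rewrite /hs_act !scalerA mulrC. Qed.

Lemma hs_act_linear f : linear (hs_act f).
Proof. by move=> c u v; rewrite /hs_act scalerDr [f *: _]hs_actC. Qed.

Lemma is_opV_submod : submod_closed is_opVb.
Proof.
apply: sums_of_submod => c U [a [b [Ulin UM Uwt]]]; exists a, b; split.
- move=> d u v; rewrite /= !fctE Ulin scalerDr !scalerA mulrC.
  by rewrite -scalerA.
- by move=> f v; rewrite !fctE UM; exact: hs_actC.
- by move=> d v /Uwt; exact: hs_wtZ.
Qed.
HB.instance Definition _ := GRing.isSubmodClosed.Build R[i]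
  (restr V -> restr V) is_opVb is_opV_submod.

Definition opV : Type := {U : restr V -> restr V | is_opVb U}.
HB.instance Definition _ := SubType.on opV.
HB.instance Definition _ := Choice.on opV.
HB.instance Definition _ := [SubChoice_isSubLmodule of opV by <:].

Lemma is_opV_linear U : is_opV U -> linear U.
Proof.
move=> oU; refine (@sums_of_ind R[i] (restr V -> restr V) _
  [set U : restr V -> restr V | linear U] _ _ _ U oU).
- by move=> c u v; rewrite scaler0 addr0.
- move=> u v ul vl c x y; rewrite !fctE ul vl scalerDr !addrA.
  by congr (_ + _); rewrite addrAC.
- by move=> W [a [b []]].
Qed.

Lemma is_opV_comp U U' : is_opV U -> is_opV U' -> is_opV (U \o U').
Proof.
move=> oU oU'; refine (@sums_of_ind R[i] (restr V -> restr V) _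
  [set U : restr V -> restr V | is_opV (U \o U')] _ _ _ U oU).
- exact: sums_of0.
- by move=> u v; exact: sums_ofD.
move=> W [a [b [Wlin WM Wwt]]].
refine (@sums_of_ind R[i] (restr V -> restr V) _
  [set U' : restr V -> restr V | is_opV (W \o U')] _ _ _ U' oU').
- rewrite /= (_ : _ \o _ = 0); first exact: sums_of0.
  apply/funext => u /=.
  by have := Wlin (-1) 0 0; rewrite !scaleN1r !addNr.
- move=> u v /= du dv; rewrite (_ : _ \o _ = (W \o u) + (W \o v)).
    exact: sums_ofD.
  by apply/funext => x; have /= := Wlin 1 (u x) (v x); rewrite !scale1r.
- move=> W' [c [d [W'lin W'M W'wt]]]; apply: sums_of_sub.
  exists (a + c), (b + d); split.
  + by move=> k u v; rewrite /= W'lin Wlin.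
  + by move=> f v; rewrite /= W'M WM shift_shift opprD.
  + move=> e v /W'wt /Wwt /=.
    rewrite (_ : e - c + d - a + b = e - (a + c) + (b + d)) //.
    by rewrite opprD [b + d]addrC [- a - c]addrC !addrA; congr (_ + _); rewrite addrAC.
Qed.

Definition opV_mul (U U' : opV) : opV :=
  exist _ (val U \o val U')
    (asboolT (is_opV_comp (asboolW (valP U)) (asboolW (valP U')))).

Lemma is_dopV_opV a b U : is_dopV a b U -> is_opVb U.
Proof. by move=> Uab; apply/asboolP/sums_of_sub; exists a, b. Qed.

Lemma is_dopV1 : is_dopV 0 0 id.
Proof.
split=> // [f v|c v]; first by rewrite oppr0 shift0.
by rewrite subr0 addr0.
Qed.

Definition opV1 : opV :=
  exist _ id (is_dopV_opV is_dopV1).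

Lemma is_dopV_mur f : is_dopV 0 0 (hs_act f).
Proof.
split; [exact: hs_act_linear|by move=> g v; rewrite oppr0 shift0 hs_actC|].
by move=> c v wv; rewrite subr0 addr0; exact: hs_wtZ.
Qed.

Definition opV_mur (f : Mero h) : opV :=
  exist _ (hs_act f) (is_dopV_opV (is_dopV_mur f)).

Lemma opV_mul_ex (f : Mero h) : exists U : opV,
  forall c (v : V), hs_wt c v -> val U v = hs_act (shift (- c) f) v.
Proof.
have act_lin c : linear ((fun v : V => shift (- c) f *: v) : V -> V).
  by move=> g u v; rewrite scalerDr !scalerA mulrC.
have [u ulin uE] := direct_sum_lift (hs_axiom V) act_lin.
suff H : is_dopV 0 0 u.
  by exists (exist _ u (is_dopV_opV H)).
split.
- by move=> c x y; exact: ulin.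
- move=> g v; rewrite oppr0 shift0.
  have u0 : u 0 = 0 by have := ulin (-1) 0 0; rewrite !scaleN1r !addNr.
  by have := ulin g v 0; rewrite u0 !addr0.
- move=> c v wv; rewrite subr0 addr0 (uE c)//; exact: hs_wtZ.
Qed.

(* The operator acting as T_{-c} f on the weight space of c *)
Definition opV_mull (f : Mero h) : opV := projT1 (cid (opV_mul_ex f)).

Definition opV_comp (a b : dual h) : set opV := [set U | is_dopV a b (val U)].

Definition opV_halgebra : halgebra_data h :=
  @HalgebraData _ _ opV opV_mul opV1 opV_comp opV_mull opV_mur.
End Restr.

Definition dynamical_representation (R : realType) (h : vectType R[i])
    (A : halgebra_data h) (V : hspace h) (phi : A -> opV_halgebra V) : Prop :=
  is_halgebra_hom phi.

Definition is_graded_hom (R : realType) (h : vectType R[i]) (I : choiceType)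
    (E F : graded h I) (phi : E -> F) : Prop :=
  [/\ linear phi, forall i g e, gr_comp i g e -> gr_comp i g (phi e)
    & forall f e, phi (gr_act f e) = gr_act f (phi e)].

Record right_corep (R : realType) (h : vectType R[i]) (A : coalgebroid h)
    (V : hspace h) := RightCorep {
  rc_map :> graded_of V -> tensorR (graded_of V) A;
  rc_hom : is_graded_hom rc_map;
  rc_coassoc : forall v,
    tensor_assoc (graded_of V) A (as_right A)
      (tensor_map (graded_of V) (as_right A)
         (tensorR (graded_of V) A) (as_right A) id id rc_map id (rc_map v)) =
    tensor_map (graded_of V) (as_right A)
      (graded_of V) (as_right (tensor_bg A A)) id id id (Delta A) (rc_map v);
  rc_counit : forall v,
    tensor_unitr (tensor_map (graded_of V) (as_right A)
      (graded_of V) (as_right (diffop_bg h)) id id id (counit A) (rc_map v)) = v }.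

Record left_corep (R : realType) (h : vectType R[i]) (A : coalgebroid h)
    (V : hspace h) := LeftCorep {
  lc_map :> graded_of V -> tensorL A (graded_of V);
  lc_hom : is_graded_hom lc_map;
  lc_coassoc : forall v,
    tensor_assoc (as_left A) A (graded_of V)
      (tensor_map (as_left A) (graded_of V)
         (as_left (tensor_bg A A)) (graded_of V) id id (Delta A) id (lc_map v)) =
    tensor_map (as_left A) (graded_of V)
      (as_left A) (tensorL A (graded_of V)) id id id lc_map (lc_map v);
  lc_counit : forall v,
    tensor_unitl (tensor_map (as_left A) (graded_of V)
      (as_left (diffop_bg h)) (graded_of V) id id (counit A) id (lc_map v)) = v }.

Section Induced.
Context (R : realType) (h : vectType R[i]) (U : halgebra h) (A : coalgebroid h).
Context (p : pairing U A) (V : hspace h).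

(* For X in U_{ab}, the map <X, .> T_b sends A_{g,d} to D_{g,d+a-b}. *)
Definition induced_right (rho : right_corep A V) (a b : dual h) (X : U)
    (v : graded_of V) : graded_of V :=
  tensor_unitr (tensor_map (graded_of V) (as_right A)
    (graded_of V) (as_right (diffop_bg h))
    id (fun d => d + a - b) id (fun x => dop_mul (p X x) (dop 1 b)) (rho v)).

(* For X in U_{ab}, the map T_a <X, .> sends A_{g,d} to D_{g+b-a,d}. *)
Definition induced_left (lambda : left_corep A V) (a b : dual h) (X : U)
    (v : graded_of V) : graded_of V :=
  tensor_unitl (tensor_map (as_left A) (graded_of V)
    (as_left (diffop_bg h)) (graded_of V)
    (fun g => g + b - a) id (fun x => dop_mul (dop 1 a) (p X x)) id (lambda v)).

(* pi is the C-linear map U -> D_{h^*,V} given on the component U_{ab} by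
   formula a b. *)
Definition extends (formula : dual h -> dual h -> U -> restr V -> restr V)
    (pi : U -> opV V) : Prop :=
  linear pi /\ forall a b X, ha_comp a b X -> val (pi X) = formula a b X.
End Induced.

(* Main.v *)
Require Import Defs.
From mathcomp Require Import all_boot all_order all_algebra.
From mathcomp Require Import complex.
From mathcomp Require Import reals.
From mathcomp Require Import boolp classical_sets functions.
From mathcomp.multinomials Require Import freeg.

Set Implicit Arguments.
Unset Strict Implicit.
Unset Printing Implicit Defensive.

Import GRing.Theory.
Local Open Scope ring_scope.
Local Open Scope complex_scope.

(** A homogeneous difference operator [f T_{-c}] acts through the function [f],
    its value at 1 ([dop_compE]).  Therefore the right corepresentation gives [pi(X) v = sum (<X, x> 1) w] over
    [R(v) = sum w (x) x], and the left one gives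
    [pi(X) v = sum T_a(<X, x> 1) w] for [X] of degree [(a, b)].  Degrees and the
    commutation with functions are read off from the degrees of the pairing; the
    product rule of the pairing together with coassociativity turns [pi(X Y)]
    into [pi(X) pi(Y)] for the right corepresentation and into [pi(Y) pi(X)] for
    the left one: if [x] has inner degree [g], then [<X, x> T_g = f T_{-a}], so
    the shift [T_g] in the product rule leaves just the shift by which [pi(X)]
    commutes with functions (for the left corepresentation, after applying
    [T_{a + c}], the shift of [pi(Y)], for [Y] of left degree [c]).  Values on
    units and moment maps come from the counit.  Since the algebra is the direct
    sum of its components, these formulas extend uniquely to a linear map.

    Sweedler sums.  The structure maps of tensor products are evaluated on a
    finite expansion into pure tensors.  For fixed [t], [tensor_lift phi t] is a finite sum of
    values of [phi] at matching pairs ([tensor_lift_sumE]), so linear maps and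
    other lifts may be moved through it freely; balancedness of [phi] matters
    only when [t] itself is rewritten as a combination of pure tensors.  In this
    language coassociativity says that a balanced trilinear expression in three
    Sweedler components does not depend on which factor of the first coproduct
    is split again ([tensor_lift_coassoc]).

    Antipode.  Composing the second representation with the antipode [S] gives a
    representation as soon as [S] reverses products, exchanges the moment maps
    and maps degree [(a, b)] to [(- b, - a)].  Everything comes from evaluating
    Sweedler sums in two ways: [sum S(x1) x2 S(x3)] gives the degree
    ([antipode_comp]), [sum S(x1 y1) x2 y2 S(y3)] gives
    [sum S(x1 y) x2 = S(y) mu_r(T_a eps(x))] ([antipode_mul_left]), and then
    [sum S(x1 y) x2 S(x3)] gives [S(x y) = S(y) S(x)] ([antipodeM]). *)

(** * Calculus in balanced tensor products *)

Section LinearMaps.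
Context (K : pzRingType) (V W : lmodType K) (f : V -> W) (flin : linear f).

Lemma linear_map0 : f 0 = 0.
Proof. by have := flin (-1) 0 0; rewrite !scaleN1r !addNr. Qed.

Lemma linear_mapD x y : f (x + y) = f x + f y.
Proof. by have := flin 1 x y; rewrite !scale1r. Qed.

Lemma linear_mapZ c x : f (c *: x) = c *: f x.
Proof. by have := flin c x 0; rewrite linear_map0 !addr0. Qed.
End LinearMaps.

Section LiftSum.
Context (R : realType) (h : vectType R[i]) (I K : choiceType).
Context (E : graded h I) (F : graded h K).

(** A lift is evaluated on one fixed representative of [t], whence a finite sum
    whose shape depends on [t] only.  This is what lets linear maps and further
    lifts be moved through [tensor_lift], and [phi] be replaced by any map with
    the same values at matching pairs. *)
Lemma tensor_lift_sumE (t : tensor E F) :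
  exists s : seq (R[i] * generator E F),
    forall (G : lmodType R[i]) (phi : I -> dual h -> K -> E -> F -> G),
    tensor_lift phi t =
    \sum_(z <- s) z.1 *: (let: (i, g, k, e, f) := val z.2 in phi i g k e f).
Proof.
exists [seq (coeff z (repr t), z) | z <- dom (repr t)] => G phi.
rewrite /tensor_lift -{1}(freeg_sumE (repr t)).
have lift_sum (r : seq (generator E F)) (a : generator E F -> formal E F) :
    formal_lift phi (\sum_(z <- r) a z) = \sum_(z <- r) formal_lift phi (a z).
  by elim/big_ind2: _ => [|? ? ? ? <- <-|//]; rewrite ?formal_lift0// formal_liftD.
rewrite lift_sum [RHS]big_map; apply: eq_bigr => z _.
by rewrite /formal_lift liftU.
Qed.

Lemma eq_tensor_lift (G : lmodType R[i])
    (phi phi' : I -> dual h -> K -> E -> F -> G) t :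
  (forall i g k e f, gr_comp i g e -> gr_comp k g f ->
     phi i g k e f = phi' i g k e f) ->
  tensor_lift phi t = tensor_lift phi' t.
Proof.
move=> eq_phi; have [s sE] := tensor_lift_sumE t; rewrite !sE.
apply: eq_bigr => -[c [[[[[i g] k] e] f] /= m]] _; congr (_ *: _).
by have [] := asboolW m; exact: eq_phi.
Qed.

Lemma linear_tensor_lift (G G' : lmodType R[i]) (L : G -> G')
    (phi : I -> dual h -> K -> E -> F -> G) t : linear L ->
  L (tensor_lift phi t) = tensor_lift (fun i g k e f => L (phi i g k e f)) t.
Proof.
move=> Llin; have [s sE] := tensor_lift_sumE t; rewrite !sE.
elim: s {sE} => [|z s IH]; first by rewrite !big_nil (linear_map0 Llin).
by rewrite !big_cons Llin IH; case: (val z.2) => -[[[i g] k] e] f.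
Qed.

Lemma tensor_lift_linear_fun (G : lmodType R[i]) c
    (phi phi' : I -> dual h -> K -> E -> F -> G) t :
  tensor_lift (fun i g k e f => c *: phi i g k e f + phi' i g k e f) t =
  c *: tensor_lift phi t + tensor_lift phi' t.
Proof.
have [s sE] := tensor_lift_sumE t; rewrite !sE scaler_sumr -big_split /=.
apply: eq_bigr => z _; case: (val z.2) => -[[[i g] k] e] f.
by rewrite scalerDr !scalerA mulrC.
Qed.

End LiftSum.

Section Exchange.
Context (R : realType) (h : vectType R[i]) (I K I' K' : choiceType).
Context (E : graded h I) (F : graded h K) (E' : graded h I') (F' : graded h K').

Lemma exchange_tensor_lift (G : lmodType R[i])
    (phi : I -> dual h -> K -> I' -> dual h -> K' -> E -> F -> E' -> F' -> G)
    (t : tensor E F) (u : tensor E' F') :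
  tensor_lift (fun i g k e f =>
    tensor_lift (fun i' g' k' e' f' => phi i g k i' g' k' e f e' f') u) t =
  tensor_lift (fun i' g' k' e' f' =>
    tensor_lift (fun i g k e f => phi i g k i' g' k' e f e' f') t) u.
Proof.
have [s sE] := tensor_lift_sumE t; have [r rE] := tensor_lift_sumE u.
rewrite sE rE.
transitivity (\sum_(z <- s) \sum_(y <- r) z.1 *: (y.1 *:
   (let: (i, g, k, e, f) := val z.2 in let: (i', g', k', e', f') := val y.2 in
    phi i g k i' g' k' e f e' f'))).
  apply: eq_bigr => z _; rewrite -scaler_sumr; congr (_ *: _).
  by case: (val z.2) => -[[[i g] k] e] f; rewrite rE.
rewrite exchange_big; apply: eq_bigr => y _.
case: (val y.2) => -[[[i' g'] k'] e'] f'; rewrite sE scaler_sumr.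
apply: eq_bigr => z _; rewrite !scalerA mulrC.
by case: (val z.2) => -[[[i g] k] e] f.
Qed.
End Exchange.

Section Balanced.
Context (R : realType) (h : vectType R[i]) (I K : choiceType).
Context (E : graded h I) (F : graded h K) (G : lmodType R[i]).
Context (cE : graded_closed E) (cF : graded_closed F).
Implicit Types phi : I -> dual h -> K -> E -> F -> G.

Lemma bilinear_balanced phi :
  (forall i g k f, linear (fun e => phi i g k e f)) ->
  (forall i g k e, linear (phi i g k e)) ->
  (forall i g k m e f, gr_comp i g e -> gr_comp k g f ->
     phi i g k (gr_act m e) f = phi i g k e (gr_act m f)) ->
  balanced phi.
Proof.
move=> linl linr actC i g k; split.
- by move=> e e' f _ _ _; exact: (linear_mapD (linl i g k f)).
- by move=> e f f' _ _ _; exact: linear_mapD.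
- move=> c e f _ _; split; first exact: (linear_mapZ (linl i g k f)).
  exact: linear_mapZ.
- by move=> m e f; exact: actC.
Qed.

Lemma linear_balanced (G' : lmodType R[i]) (L : G -> G') phi : linear L ->
  balanced phi -> balanced (fun i g k e f => L (phi i g k e f)).
Proof.
move=> Ll bphi i g k; have [Dl Dr Z M] := bphi i g k; split.
- by move=> e e' f Ee Ee' Ff; rewrite Dl// (linear_mapD Ll).
- by move=> e f f' Ee Ff Ff'; rewrite Dr// (linear_mapD Ll).
- by move=> c e f Ee Ff; have [-> ->] := Z c e f Ee Ff; rewrite (linear_mapZ Ll).
- by move=> m e f Ee Ff; rewrite M.
Qed.

Lemma tensor_lift0 phi : balanced phi -> tensor_lift phi 0 = 0.
Proof. by move=> bphi; exact: linear_map0 (tensor_lift_linear cE cF bphi). Qed.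

Lemma tensor_liftD phi t u : balanced phi ->
  tensor_lift phi (t + u) = tensor_lift phi t + tensor_lift phi u.
Proof. by move=> bphi; exact: linear_mapD (tensor_lift_linear cE cF bphi) t u. Qed.

(** The representative on which a lift is evaluated may involve pairs of other
    outer degrees than those of [t]; a balanced map does not see them, because
    [t] is also a sum of pure tensors of the right degrees. *)
Lemma eq_tensor_lift_comp phi phi' i k t : balanced phi -> balanced phi' ->
  tensor_comp i k t ->
  (forall g e f, gr_comp i g e -> gr_comp k g f ->
     phi i g k e f = phi' i g k e f) ->
  tensor_lift phi t = tensor_lift phi' t.
Proof.
move=> bphi bphi' ti eq_phi.
refine (@sums_of_ind R[i] _ _ [set t | tensor_lift phi t = tensor_lift phi' t]
  _ _ _ t ti) => /=.
- by rewrite !tensor_lift0.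
- by move=> u v uE vE; rewrite !tensor_liftD// uE vE.
- move=> _ [g [e [f [Ee Ff ->]]]]; rewrite /= !tensor_lift_pure//.
  exact: eq_phi.
Qed.

Lemma tensor_lift_comp_ind (Q : set G) phi i k t : balanced phi ->
  tensor_comp i k t -> Q 0 -> (forall u v, Q u -> Q v -> Q (u + v)) ->
  (forall g e f, gr_comp i g e -> gr_comp k g f -> Q (phi i g k e f)) ->
  Q (tensor_lift phi t).
Proof.
move=> bphi ti Q0 QD Qphi.
refine (@sums_of_ind R[i] _ _ [set t | Q (tensor_lift phi t)] _ _ _ t ti) => /=.
- by rewrite tensor_lift0.
- by move=> u v uE vE; rewrite tensor_liftD//; exact: QD.
- by move=> _ [g [e [f [Ee Ff ->]]]]; rewrite /= tensor_lift_pure//; exact: Qphi.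
Qed.

End Balanced.

Section TensorMap.
Context (R : realType) (h : vectType R[i]) (I K I' K' : choiceType).
Context (E : graded h I) (F : graded h K) (E' : graded h I') (F' : graded h K').
Context (cE' : graded_closed E') (cF' : graded_closed F').
Context (a : I -> I') (b : K -> K') (phi : E -> E') (psi : F -> F').

Lemma tensor_lift_map (G : lmodType R[i])
    (Phi : I' -> dual h -> K' -> E' -> F' -> G) t :
  balanced Phi ->
  (forall i g k e f, gr_comp i g e -> gr_comp k g f ->
     gr_comp (a i) g (phi e) /\ gr_comp (b k) g (psi f)) ->
  tensor_lift Phi (tensor_map E F E' F' a b phi psi t) =
  tensor_lift (fun i g k e f => Phi (a i) g (b k) (phi e) (psi f)) t.
Proof.
move=> bPhi comp; rewrite /tensor_map linear_tensor_lift; last first.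
  exact: tensor_lift_linear.
apply: eq_tensor_lift => i g k e f Ee Ff.
by have [] := comp _ _ _ _ _ Ee Ff; exact: tensor_lift_pure.
Qed.

Lemma tensor_map_comp i k t :
  graded_closed E -> graded_closed F ->
  balanced (fun i g k e f => pure (a i) g (b k) (phi e) (psi f) : tensor E' F') ->
  (forall i g k e f, gr_comp i g e -> gr_comp k g f ->
     gr_comp (a i) g (phi e) /\ gr_comp (b k) g (psi f)) ->
  tensor_comp i k t ->
  tensor_comp (a i) (b k) (tensor_map E F E' F' a b phi psi t).
Proof.
move=> cE cF bpure comp ti.
apply: (tensor_lift_comp_ind cE cF bpure ti).
- exact: sums_of0.
- by move=> u v; exact: sums_ofD.
- move=> g e f Ee Ff; have [Ee' Ff'] := comp _ _ _ _ _ Ee Ff.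
  by apply: sums_of_sub; exists g, (phi e), (psi f).
Qed.
End TensorMap.

(** * Prealgebras as tensor factors, and reassociation *)

Section TensorActions.
Context (R : realType) (h : vectType R[i]).

Lemma pure_balanced (I K : choiceType) (E : graded h I) (F : graded h K) :
  balanced (fun i g k e f => pure i g k e f : tensor E F).
Proof.
have rel (x y : formal E F) : tensor_rel (x - y) -> tensor_pi x = tensor_pi y.
  move=> xy; apply/tensor_piP/asboolP/sums_of_sub.
  by exists 1, (x - y); rewrite scale1r.
have piZ (c : R[i]) (x : formal E F) : tensor_pi (c *: x) = c *: tensor_pi x.
  by rewrite -tensor_scale_pi.
move=> i g k; split.
- by move=> e e' f Ee Ee' Ff; rewrite /pure -tensor_piD; apply: rel; exact: TensorDl.
- by move=> e f f' Ee Ff Ff'; rewrite /pure -tensor_piD; apply: rel; exact: TensorDr.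
- move=> c e f Ee Ff; rewrite /pure -piZ; split; apply: rel.
    exact: TensorZl.
  exact: TensorZr.
- by move=> m e f Ee Ff; apply: rel; exact: TensorM.
Qed.

Lemma balanced_comp (I K I' K' : choiceType)
    (E : graded h I) (F : graded h K) (E' : graded h I') (F' : graded h K')
    (G : lmodType R[i]) (a : I -> I') (b : K -> K') (phi : E -> E') (psi : F -> F')
    (Phi : I' -> dual h -> K' -> E' -> F' -> G) :
  balanced Phi -> linear phi -> linear psi ->
  (forall i g e, gr_comp i g e -> gr_comp (a i) g (phi e)) ->
  (forall k g f, gr_comp k g f -> gr_comp (b k) g (psi f)) ->
  (forall m e, phi (gr_act m e) = gr_act m (phi e)) ->
  (forall m f, psi (gr_act m f) = gr_act m (psi f)) ->
  balanced (fun i g k e f => Phi (a i) g (b k) (phi e) (psi f)).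
Proof.
move=> bPhi phil psil phic psic phia psia i g k.
have [Dl Dr Z M] := bPhi (a i) g (b k).
split.
- by move=> e e' f Ee Ee' Ff; rewrite (linear_mapD phil) Dl//; auto.
- by move=> e f f' Ee Ff Ff'; rewrite (linear_mapD psil) Dr//; auto.
- by move=> c e f Ee Ff; rewrite (linear_mapZ phil) (linear_mapZ psil); apply: Z; auto.
- by move=> m e f Ee Ff; rewrite phia psia; apply: M; auto.
Qed.

Section Factors.
Context (A : bigraded h) (pA : is_prealgebra A).

Lemma as_left_closed : graded_closed (as_left A).
Proof.
have [[W0 _ _] [_ [rl _ _ _]] _ pc] := pA => i g.
have [w0 wD] := W0 (i, g).
split.
- by move=> e e' Ee Ee'; have := wD 1 e e' Ee Ee'; rewrite scale1r.
- by move=> c e Ee; have := wD c e 0 Ee w0; rewrite addr0.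
- by move=> m e /(pc _ _ m)[].
Qed.

Lemma as_right_closed : graded_closed (as_right A).
Proof.
have [[W0 _ _] _ _ pc] := pA => i g.
have [w0 wD] := W0 (g, i).
split.
- by move=> e e' Ee Ee'; have := wD 1 e e' Ee Ee'; rewrite scale1r.
- by move=> c e Ee; have := wD c e 0 Ee w0; rewrite addr0.
- by move=> m e /(pc _ _ m)[].
Qed.

Lemma balanced_tensorR (I : choiceType) (E : graded h I) (G : lmodType R[i]) m
    (Phi : I -> dual h -> dual h -> E -> as_right A -> G) : balanced Phi ->
  balanced (fun i g k e (x : as_right A) => Phi i g k e (bg_mur m (x : A))).
Proof.
move=> bPhi.
have [_ [_ [rl _ _ _]] lr pc] := pA.
apply: (balanced_comp (a := id) (b := id) (phi := id)
  (psi := bg_mur m : as_right A -> as_right A) bPhi) => //.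
- by move=> k g f /(pc _ _ m)[].
- by move=> m' f; rewrite /= lr.
Qed.

Lemma balanced_tensorL (K : choiceType) (F : graded h K) (G : lmodType R[i]) m
    (Phi : dual h -> dual h -> K -> as_left A -> F -> G) : balanced Phi ->
  balanced (fun i g k (x : as_left A) f => Phi i g k (bg_mul m (x : A)) f).
Proof.
move=> bPhi.
have [_ [[ll _ _ _] _] lr pc] := pA.
apply: (balanced_comp (a := id) (b := id) (psi := id)
  (phi := bg_mul m : as_left A -> as_left A) bPhi) => //.
- by move=> k g f /(pc _ _ m)[].
- by move=> m' f; rewrite /= lr.
Qed.

Lemma tensorR_closed (I : choiceType) (E : graded h I) :
  graded_closed E -> graded_closed (tensorR E A).
Proof.
move=> cE i k; have [_ _ _ pc] := pA; split.
- by move=> t u; exact: sums_ofD.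
- move=> c t; apply: (@sums_of_ind R[i] (tensor E (as_right A)) _
    [set t : tensor E (as_right A) | tensor_comp i k (c *: t)]) => /=.
  + by rewrite scaler0; exact: sums_of0.
  + by move=> u v; rewrite scalerDr; exact: sums_ofD.
  + move=> _ [g [e [f [Ee Ff ->]]]] /=; have [_ EZ _] := cE i g.
    apply: sums_of_sub; exists g, (c *: e), f; split=> //; first exact: EZ.
    by have [_ _ Z _] := pure_balanced E (as_right A) i g k; case: (Z c e f Ee Ff).
- move=> m t; apply: (tensor_map_comp (a := id) (b := id)) => //.
  + exact: as_right_closed.
  + by apply: balanced_tensorR; exact: pure_balanced.
  + by move=> i' g k' e f Ee /(pc _ _ m)[].
Qed.

Lemma tensorL_closed (K : choiceType) (F : graded h K) :
  graded_closed F -> graded_closed (tensorL A F).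
Proof.
move=> cF k i; have [_ _ _ pc] := pA; split.
- by move=> t u; exact: sums_ofD.
- move=> c t; apply: (@sums_of_ind R[i] (tensor (as_left A) F) _
    [set t : tensor (as_left A) F | tensor_comp i k (c *: t)]) => /=.
  + by rewrite scaler0; exact: sums_of0.
  + by move=> u v; rewrite scalerDr; exact: sums_ofD.
  + move=> _ [g [e [f [Ee Ff ->]]]] /=; have [_ FZ _] := cF k g.
    apply: sums_of_sub; exists g, e, (c *: f); split=> //; first exact: FZ.
    by have [_ _ Z _] := pure_balanced (as_left A) F i g k; case: (Z c e f Ee Ff).
- move=> m t; apply: (tensor_map_comp (a := id) (b := id)) => //.
  + exact: as_left_closed.
  + by apply: balanced_tensorL; exact: pure_balanced.
  + by move=> i' g k' e f /(pc _ _ m)[].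
Qed.

End Factors.
End TensorActions.

Section Assoc.
Context (R : realType) (h : vectType R[i]) (I K : choiceType).
Context (E : graded h I) (A : bigraded h) (F : graded h K) (G : lmodType R[i]).
Context (cE : graded_closed E) (pA : is_prealgebra A) (cF : graded_closed F).
Context (Phi : I -> dual h -> dual h -> K -> E -> A -> F -> G).

(** A trilinear map [Phi i g b k] on [E_{ig} x A_{gb} x F_{kb}], balanced over
    both inner degrees.  Each balancing relation is required for every value of
    the factor it does not involve, so that fixing [e] or [f] leaves a balanced
    bilinear map. *)
Definition trilinear_balanced : Prop :=
  [/\ forall i g b k x f, linear (fun e => Phi i g b k e x f),
      forall i g b k e f, linear (fun x => Phi i g b k e x f),
      forall i g b k e x, linear (Phi i g b k e x),
      forall i g b k m e x f, gr_comp i g e -> bg_comp g b x ->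
        Phi i g b k (gr_act m e) x f = Phi i g b k e (bg_mul m x) f
    & forall i g b k m e x f, bg_comp g b x -> gr_comp k b f ->
        Phi i g b k e (bg_mur m x) f = Phi i g b k e x (gr_act m f)].

Definition contract_left (_ : I) (_ : dual h) (k : K) (t : tensorR E A) (f : F) : G :=
  tensor_lift (fun i' g b' e (x : as_right A) => Phi i' g b' k e x f) t.

Definition contract_right (i : I) (_ : dual h) (_ : K) (e : E) (u : tensorL A F) : G :=
  tensor_lift (fun g' b k' (x : as_left A) f => Phi i g' b k' e x f) u.

Hypothesis bPhi : trilinear_balanced.

Lemma trilinear_balanced_left k f :
  balanced (fun i' g b' e (x : as_right A) => Phi i' g b' k e x f).
Proof.
have [le lx lf re rf] := bPhi; apply: bilinear_balanced => //.
by move=> i g b m e x; exact: re.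
Qed.

Lemma trilinear_balanced_right i e :
  balanced (fun g' b k' (x : as_left A) f => Phi i g' b k' e x f).
Proof.
have [le lx lf re rf] := bPhi; apply: bilinear_balanced => //.
by move=> g b k m x f; exact: rf.
Qed.

Let balanced_left := @trilinear_balanced_left.
Let balanced_right := @trilinear_balanced_right.

Lemma contract_left_balanced : balanced contract_left.
Proof.
have [le lx lf re rf] := bPhi; have [_ _ _ pc] := pA.
have cA := as_right_closed pA.
move=> i b k; split.
- by move=> t t' f _ _ _; exact: tensor_liftD.
- move=> t f f' _ _ _; rewrite /contract_left -[in RHS](scale1r (tensor_lift _ t)).
  rewrite -tensor_lift_linear_fun; apply: eq_tensor_lift => i' g k' e x _ _.
  by rewrite scale1r (linear_mapD (lf i' g k' k e x)).
- move=> c t f _ _; split.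
    exact: (linear_mapZ (tensor_lift_linear cE cA (@trilinear_balanced_left k f))).
  rewrite /contract_left (linear_tensor_lift (L := fun u : G => c *: u)); last first.
    by move=> d u v; rewrite scalerDr !scalerA mulrC.
  apply: eq_tensor_lift => i' g k' e x _ _.
  exact: (linear_mapZ (lf i' g k' k e x)).
- move=> m t f tib Ff; rewrite /contract_left /= tensor_lift_map//; last first.
    by move=> i' g k' e x Ee /(pc _ _ m)[].
  apply: (eq_tensor_lift_comp cE cA _ _ tib) => //.
    exact: (balanced_tensorR pA m (@trilinear_balanced_left k f)).
  by move=> g e x Ee xA; exact: rf.
Qed.

Lemma contract_right_balanced : balanced contract_right.
Proof.
have [le lx lf re rf] := bPhi; have [_ _ lr pc] := pA.
have cA := as_left_closed pA.
move=> i g k; split.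
- move=> e e' u _ _ _; rewrite /contract_right -[in RHS](scale1r (tensor_lift _ u)).
  rewrite -tensor_lift_linear_fun; apply: eq_tensor_lift => g' b k' x f _ _.
  by rewrite scale1r (linear_mapD (le i g' b k' x f)).
- by move=> e u u' _ _ _; exact: tensor_liftD.
- move=> c e u _ _; split; last first.
    exact: (linear_mapZ (tensor_lift_linear cA cF (@trilinear_balanced_right i e))).
  rewrite /contract_right (linear_tensor_lift (L := fun u : G => c *: u)); last first.
    by move=> d u' v; rewrite scalerDr !scalerA mulrC.
  apply: eq_tensor_lift => g' b k' x f _ _.
  exact: (linear_mapZ (le i g' b k' x f)).
- move=> m e u Ee ugk; rewrite /contract_right /= tensor_lift_map//; last first.
    by move=> i' g' k' x f /(pc _ _ m)[].
  apply: (eq_tensor_lift_comp cA cF _ _ ugk) => //.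
    exact: (balanced_tensorL pA m (@trilinear_balanced_right i e)).
  by move=> b x f xA Ff; exact: re.
Qed.

Lemma tensor_lift_assoc (T : tensor (tensorR E A) F) :
  tensor_lift contract_right (tensor_assoc E A F T) = tensor_lift contract_left T.
Proof.
have [le lx lf re rf] := bPhi; have [_ _ lr pc] := pA.
have cL := tensorL_closed pA cF.
have cA := as_right_closed pA.
have lin := tensor_lift_linear cE cL contract_right_balanced.
rewrite /tensor_assoc linear_tensor_lift//.
apply: eq_tensor_lift => i b k t f tib Ff.
rewrite linear_tensor_lift//.
transitivity (tensor_lift (fun i' g b' e (x : as_right A) =>
   if (i' == i) && (b' == b) then Phi i' g b' k e x f else 0) t).
  apply: eq_tensor_lift => i' g b' e x Ee xA.
  case: andP => [[/eqP ei /eqP eb]|_]; last first.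
    by rewrite tensor_lift0//; exact: contract_right_balanced.
  subst i' b'; rewrite tensor_lift_pure//; last 2 first.
  - exact: contract_right_balanced.
  - by apply: sums_of_sub; exists b, (x : A), f.
  by rewrite /contract_right tensor_lift_pure//; exact: as_left_closed.
(* [t] has outer degrees [i] and [b], so the degree test discards nothing *)
apply: (eq_tensor_lift_comp cE cA _ _ tib) => //.
  move=> i' g b'; case: (altP andP) => /= _; last first.
    by split=> *; rewrite ?addr0 ?scaler0.
  exact: trilinear_balanced_left.
by move=> g e x _ _; rewrite !eqxx.
Qed.

(** Coassociativity in Sweedler form, obtained by contracting both sides of the
    coassociativity equation with [Phi].  It covers coproducts and left and right
    corepresentations alike: [rho] splits the first factor and [lam] the
    second. *)
Lemma tensor_lift_coassoc (E0 : graded h I) (F0 : graded h K)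
    (rho : E0 -> tensorR E A) (lam : F0 -> tensorL A F)
    (t : tensor E0 F) (t' : tensor E F0) :
  (forall i g e, gr_comp i g e -> gr_comp i g (rho e)) ->
  (forall k g f, gr_comp k g f -> gr_comp k g (lam f)) ->
  tensor_assoc E A F (tensor_map E0 F (tensorR E A) F id id rho id t) =
  tensor_map E F0 E (tensorL A F) id id id lam t' ->
  tensor_lift (fun i b k e0 f =>
    tensor_lift (fun i' g b' e (x : as_right A) => Phi i' g b' k e x f) (rho e0)) t =
  tensor_lift (fun i g k e f0 =>
    tensor_lift (fun g' b k' (x : as_left A) f => Phi i g' b k' e x f) (lam f0)) t'.
Proof.
move=> rhoc lamc /(congr1 (tensor_lift contract_right)).
have cL := tensorL_closed pA cF; have cR := tensorR_closed pA cE.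
rewrite tensor_lift_assoc tensor_lift_map//; last 2 first.
- exact: contract_left_balanced.
- by move=> i g k e f Ee Ff; split=> //; exact: rhoc.
rewrite tensor_lift_map//.
- exact: contract_right_balanced.
- by move=> i g k e f Ee Ff; split=> //; exact: lamc.
Qed.

End Assoc.

(** * Difference operators and the unit constraints *)

Section DiffOp.
Context (R : realType) (h : vectType R[i]).
Implicit Types (P Q : diffop h) (f u : Mero h) (a b c : dual h).

Definition at1 P : Mero h := val P 1.

Lemma at1_linear : linear at1. Proof. by []. Qed.

Lemma at10 : at1 0 = 0. Proof. by []. Qed.

Lemma at1_dop_mul P Q : at1 (dop_mul P Q) = val P (at1 Q).
Proof. by []. Qed.

Lemma at1_mulr P a : at1 (dop_mul P (dop 1 a)) = at1 P.
Proof. by rewrite at1_dop_mul /at1 /= /dop_fun shift1 mul1r. Qed.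

Lemma at1_mull a P : at1 (dop_mul (dop 1 a) P) = shift a (at1 P).
Proof. by rewrite at1_dop_mul /= /dop_fun mul1r. Qed.

Lemma at1_mulf f P : at1 (dop_mul (dop f 0) P) = f * at1 P.
Proof. by rewrite at1_dop_mul /= /dop_fun shift0. Qed.

Lemma at1_fmul f P : at1 (dop_mul P (dop f 0)) = val P f.
Proof. by rewrite at1_dop_mul /at1 /= /dop_fun shift0 mulr1. Qed.

(** The unit constraints keep only the function [f] of an operator [f T_{-a}];
    nothing is lost, since the shift is determined by the degree. *)
Lemma dop_compE a b P u : dop_comp a b P -> val P u = at1 P * shift (- a) u.
Proof.
rewrite /dop_comp /=; case: eqP => _ => [[f ->]|->].
  by rewrite /at1 /= /dop_fun shift1 mulr1.
by rewrite /at1 /= mul0r.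
Qed.

Lemma diffop_linear P : linear (val P).
Proof.
have := asboolW (valP P); move: (val P).
apply: (@sums_of_ind R[i] (Mero h -> Mero h) _ [set T | linear T]) => /=.
- by move=> c u v; rewrite scaler0 addr0.
- move=> T T' Tl Tl' c u v; rewrite !fctE Tl Tl' scalerDr !addrA.
  by congr (_ + _); rewrite addrAC.
- move=> _ [f [a ->]] c u v.
  by rewrite /dop_fun shift_linear mulrDr -scalerAr.
Qed.

Lemma dop_comp_neq a b P : a != b -> dop_comp a b P -> P = 0.
Proof. by rewrite /dop_comp /= => /negPf ->. Qed.

Lemma dop_comp_sym a b P : dop_comp a b P -> dop_comp b a P.
Proof. by rewrite /dop_comp /= eq_sym; case: eqP => // ->. Qed.

Lemma dop_comp_shiftr a b c P :
  dop_comp a b P -> dop_comp (a - c) (b - c) (dop_mul P (dop 1 c)).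
Proof.
rewrite /dop_comp /= (inj_eq (addIr _)); case: eqP => _ => [[f ->]|->].
  exists f; apply/val_inj/funext => u; rewrite /= /dop_fun mul1r shift_shift.
  by rewrite opprB addrC.
exact/val_inj.
Qed.

Lemma shift00 a : shift a 0 = 0 :> Mero h.
Proof. exact: linear_map0 (shift_linear a). Qed.

Lemma dop_comp_shiftl a b c P :
  dop_comp a b P -> dop_comp (a - c) (b - c) (dop_mul (dop 1 c) P).
Proof.
rewrite /dop_comp /= (inj_eq (addIr _)); case: eqP => _ => [[f ->]|->].
  exists (shift c f); apply/val_inj/funext => u.
  by rewrite /= /dop_fun mul1r shiftM shift_shift opprB.
by apply/val_inj/funext => u; rewrite /= /dop_fun mul1r shift00.
Qed.

Lemma dop_comp_closed a b :
  [/\ forall P Q, dop_comp a b P -> dop_comp a b Q -> dop_comp a b (P + Q),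
      forall k P, dop_comp a b P -> dop_comp a b (k *: P)
    & forall f P, dop_comp a b P -> dop_comp a b (dop_mul (dop f 0) P)].
Proof.
rewrite /dop_comp /=; case: eqP => _; split.
- move=> P Q [f ->] [g ->]; exists (f + g); apply/val_inj/funext => u.
  by rewrite /= !fctE /dop_fun mulrDl.
- move=> k P [f ->]; exists (k *: f); apply/val_inj/funext => u.
  by rewrite /= !fctE /dop_fun -scalerAl.
- move=> f P [g ->]; exists (f * g); apply/val_inj/funext => u.
  by rewrite /= /dop_fun shift0 mulrA.
- by move=> P Q -> ->; rewrite addr0.
- by move=> k P ->; rewrite scaler0.
- move=> f P ->; apply/val_inj/funext => u.
  by rewrite /= /dop_fun shift00 mulr0.
Qed.

Lemma as_left_diffop_closed : graded_closed (as_left (diffop_bg h)).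
Proof. by move=> i g; exact: dop_comp_closed. Qed.

Lemma as_right_diffop_closed : graded_closed (as_right (diffop_bg h)).
Proof. by move=> i g; exact: dop_comp_closed. Qed.

End DiffOp.

Section Actions.
Context (R : realType) (h : vectType R[i]).

Section IsAction.
Context (V : lmodType R[i]) (act : Mero h -> V -> V) (actP : is_action act).

Lemma act_linear v : linear (fun f => act f v).
Proof.
have [_ cst D M] := actP; move=> c f g.
by rewrite D -[c *: f]/(mero_cst h c * f) M cst.
Qed.

Lemma act1 v : act 1 v = v.
Proof. by have [_ cst _ _] := actP; rewrite -mero_cst1 cst scale1r. Qed.

Lemma act0 v : act 0 v = 0.
Proof. exact: linear_map0 (act_linear v). Qed.

Lemma actC f g v : act f (act g v) = act g (act f v).
Proof. by have [_ _ _ M] := actP; rewrite -!M mulrC. Qed.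
End IsAction.

Section Unit.
Context (I K : choiceType) (E : graded h I) (F : graded h K).

(** The unit constraint sees an operator [P] through its value at 1 only, which
    is compatible with the balancing because [(f P) 1 = f (P 1)]. *)
Lemma tensor_unitr_map (b : K -> dual h) (psi : F -> diffop h) t :
  graded_closed E -> is_action (@gr_act _ _ _ E) ->
  (forall k g f, gr_comp k g f -> dop_comp g (b k) (psi f)) ->
  tensor_unitr (tensor_map E F E (as_right (diffop_bg h)) id b id psi t) =
  tensor_lift (fun i g k e f => gr_act (at1 (psi f)) e) t.
Proof.
move=> cE aE comp; have [El _ _ EM] := aE.
rewrite /tensor_unitr tensor_lift_map//.
- exact: as_right_diffop_closed.
- apply: bilinear_balanced.
  + by move=> i g k P; exact: El.
  + by move=> i g k e c P Q; exact: (act_linear aE).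
  + move=> i g k m e P _ _; rewrite -EM; congr gr_act.
    by rewrite /= mulrC -(at1_mulf m P).
- by move=> i g k e f Ee Ff; split=> //; exact: comp.
Qed.

Lemma tensor_unitl_map (a : I -> dual h) (phi : E -> diffop h) t :
  graded_closed F -> is_action (@gr_act _ _ _ F) ->
  (forall i g e, gr_comp i g e -> dop_comp (a i) g (phi e)) ->
  tensor_unitl (tensor_map E F (as_left (diffop_bg h)) F a id phi id t) =
  tensor_lift (fun i g k e f => gr_act (at1 (phi e)) f) t.
Proof.
move=> cF aF comp; have [Fl _ _ FM] := aF.
rewrite /tensor_unitl tensor_lift_map//.
- exact: as_left_diffop_closed.
- apply: bilinear_balanced.
  + by move=> i g k f c P Q; exact: (act_linear aF).
  + by move=> i g k P; exact: Fl.
  + move=> i g k m P f _ _; rewrite -FM; congr gr_act.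
    by rewrite [RHS]mulrC -(at1_mulf m P).
- by move=> i g k e f Ee Ff; split=> //; exact: comp.
Qed.
End Unit.

Section Coalgebroid.
Context (A : bigraded h) (pA : is_prealgebra A) (C : coalgebroid_on A).

Lemma left_actionP : is_action (@gr_act _ _ _ (as_left A)).
Proof. by have [_ []] := pA. Qed.

Lemma right_actionP : is_action (@gr_act _ _ _ (as_right A)).
Proof. by have [_ []] := pA. Qed.

Lemma counitl_lift x :
  tensor_lift (fun _ _ _ (y : as_left A) (z : as_right A) =>
    bg_mul (at1 (counit C y)) (z : A)) (Delta C x) = x.
Proof.
rewrite -[RHS](counit_left C) tensor_unitl_map//.
- exact: as_right_closed.
- exact: right_actionP.
- by have [_ comp _ _] := counit_hom C; move=> i g e; exact: comp.
Qed.

Lemma counitr_lift x :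
  tensor_lift (fun _ _ _ (y : as_left A) (z : as_right A) =>
    bg_mur (at1 (counit C z)) (y : A)) (Delta C x) = x.
Proof.
rewrite -[RHS](counit_right C) tensor_unitr_map//.
- exact: as_left_closed.
- exact: left_actionP.
- by have [_ comp _ _] := counit_hom C; move=> k g e; exact: comp.
Qed.

Lemma Delta_coassoc_lift (G : lmodType R[i])
    (Phi : dual h -> dual h -> dual h -> dual h -> A -> A -> A -> G) x :
  trilinear_balanced (E := as_left A) (F := as_right A) Phi ->
  tensor_lift (fun i b k (t : as_left A) (z : as_right A) =>
    tensor_lift (fun i' g b' (y : as_left A) (y' : as_right A) =>
      Phi i' g b' k y y' z) (Delta C t)) (Delta C x) =
  tensor_lift (fun i g k (y : as_left A) (t : as_right A) =>
    tensor_lift (fun g' b k' (y' : as_left A) (z : as_right A) =>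
      Phi i g' b k' y y' z) (Delta C t)) (Delta C x).
Proof.
move=> bPhi; have [_ comp _ _] := Delta_hom C.
apply: (tensor_lift_coassoc (as_left_closed pA) pA (as_right_closed pA) bPhi
  (E0 := as_left A) (F0 := as_right A)) => //.
- by move=> i g e; exact: comp.
- exact: Delta_coassoc.
Qed.
End Coalgebroid.

End Actions.

(** * Maps out of an algebra given on homogeneous elements *)

Section Homogeneous.
Context (R : realType) (h : vectType R[i]).

Lemma prealgebra_ind (A : bigraded h) (pA : is_prealgebra A) (Q : set A) :
  Q 0 -> (forall x y, Q x -> Q y -> Q (x + y)) ->
  (forall a b x, bg_comp a b x -> Q x) -> forall x, Q x.
Proof.
move=> Q0 QD Qc x; have [[_ /(_ x)[s [w [_ Ww ->]]] _] _ _ _] := pA.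
elim/big_ind: _ => // i _; exact: (Qc i.1 i.2).
Qed.

Lemma prealgebra_ext (A : bigraded h) (G : lmodType R[i]) (f g : A -> G) :
  is_prealgebra A -> linear f -> linear g ->
  (forall a b x, bg_comp a b x -> f x = g x) -> f = g.
Proof.
move=> pA fl gl fg; apply/funext.
apply: (prealgebra_ind pA) => [|x y xE yE|a b x]; last exact: fg.
  by rewrite (linear_map0 fl) (linear_map0 gl).
by rewrite (linear_mapD fl) (linear_mapD gl) xE yE.
Qed.

Section HSpace.
Context (V : hspace h).

Lemma hspace_ind (Q : set (restr V)) :
  Q 0 -> (forall x y, Q x -> Q y -> Q (x + y)) ->
  (forall c v, hs_wt c v -> Q v) -> forall v, Q v.
Proof.
move=> Q0 QD Qc v; have [_ /(_ v)[s [w [_ Ww ->]]] _] := hs_axiom V.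
elim/big_ind: _ => // i _; exact: (Qc i).
Qed.

Lemma hs_wt0 c : hs_wt c (0 : V).
Proof. by have [/(_ c)[]] := hs_axiom V. Qed.

Lemma hs_wtD c (u v : V) : hs_wt c u -> hs_wt c v -> hs_wt c (u + v).
Proof.
have [/(_ c)[_ wD] _ _] := hs_axiom V => cu cv.
by have := wD 1 u v cu cv; rewrite scale1r.
Qed.

Lemma graded_of_closed : graded_closed (graded_of V).
Proof.
move=> i g; split.
- exact: hs_wtD.
- by move=> c v; exact: hs_wtZ.
- by move=> m v; exact: hs_wtZ.
Qed.

Lemma hs_actionP : is_action (@hs_act _ _ V).
Proof.
split=> //.
- by move=> f; exact: hs_act_linear.
- by move=> f g v; rewrite /hs_act scalerDl.
- by move=> f g v; rewrite /hs_act scalerA.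
Qed.

(** [opV_mull f] is obtained by a choice; its values on weight vectors determine
    it because the weight spaces span. *)
Lemma opV_mullP f (P : opV V) :
  (forall c (v : V), hs_wt c v -> val P v = hs_act (shift (- c) f) v) ->
  P = opV_mull V f.
Proof.
move=> PE; have QE := projT2 (cid (opV_mul_ex V f)).
apply/val_inj/funext.
have Plin := is_opV_linear (asboolW (valP P)).
have Qlin := is_opV_linear (asboolW (valP (opV_mull V f))).
apply: hspace_ind => [|x y xE yE|c w wc].
- by rewrite (linear_map0 Plin) (linear_map0 Qlin).
- by rewrite (linear_mapD Plin) (linear_mapD Qlin) xE yE.
- by rewrite (PE c w wc); apply/esym/QE.
Qed.

Lemma opV_mul_linearl (P : opV V) : linear (fun Q : opV V => opV_mul Q P).
Proof. by move=> c Q Q'; exact/val_inj. Qed.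

Lemma opV_mul_linearr (P : opV V) : linear (opV_mul P).
Proof.
move=> c Q Q'; apply/val_inj/funext => v.
exact: (is_opV_linear (asboolW (valP P))).
Qed.
End HSpace.

Section Extension.
Context (U : halgebra h) (V : hspace h).

Lemma extends_unique F (pi pi' : U -> opV V) :
  extends F pi -> extends F pi' -> pi' = pi.
Proof.
move=> [pil piE] [pil' piE'].
apply: (prealgebra_ext (ha_prealgebra U) pil' pil) => a b X Xab.
by apply/val_inj; rewrite (piE a b) ?(piE' a b).
Qed.

(** The map [F a b] is meant for the component of degree [(a, b)]; elsewhere its
    values are discarded. *)
Lemma extends_exists (F : dual h -> dual h -> U -> restr V -> restr V) :
  (forall a b, linear (F a b)) ->
  (forall a b X, ha_comp a b X -> is_opV (F a b X)) ->
  exists pi : U -> opV V, extends F pi.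
Proof.
move=> Flin FopV; have [dsU _ _ _] := ha_prealgebra U.
have [u ulin uE] := direct_sum_lift dsU (fun ab => Flin ab.1 ab.2).
have uopV X : is_opVb (u X).
  apply/asboolP; move: X; apply: (prealgebra_ind (ha_prealgebra U)).
  - by rewrite (linear_map0 ulin); exact: sums_of0.
  - by move=> x y ux uy; rewrite (linear_mapD ulin); exact: sums_ofD.
  - by move=> a b x xab; rewrite (uE (a, b)) //; exact: FopV.
exists (fun X => exist _ (u X) (uopV X)); split.
- by move=> c X Y; apply/val_inj; rewrite /= ulin.
- by move=> a b X Xab /=; rewrite (uE (a, b)).
Qed.

Lemma bilinear_ext (G : lmodType R[i]) (m m' : U -> U -> G) :
  (forall Y, linear (fun X => m X Y)) -> (forall X, linear (m X)) ->
  (forall Y, linear (fun X => m' X Y)) -> (forall X, linear (m' X)) ->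
  (forall a b c d X Y, ha_comp a b X -> ha_comp c d Y -> m X Y = m' X Y) ->
  forall X Y, m X Y = m' X Y.
Proof.
move=> ml mr ml' mr' mE X Y.
have -> : m X = m' X; last by [].
apply: (prealgebra_ext (ha_prealgebra U)) => // c d Y' Ycd.
have /(congr1 (@^~ X)) : m^~ Y' = m'^~ Y'; last by [].
apply: (prealgebra_ext (ha_prealgebra U)) => // a b X' Xab.
exact: mE Xab Ycd.
Qed.
End Extension.

End Homogeneous.

(** * Representations induced by corepresentations *)

Section PairingAtOne.
Context (R : realType) (h : vectType R[i]) (U : halgebra h) (A : coalgebroid h).
Context (p : pairing U A).

Lemma pr_compE a b X c d x u : ha_comp a b X -> bg_comp c d x ->
  val (p X x) u = at1 (p X x) * shift (- (a + d)) u.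
Proof. by move=> Xab xcd; exact: dop_compE (pr_comp p Xab xcd). Qed.

(** Shifting [f] by the degree [d] of [x], as in the rule for right moment maps,
    cancels the contribution of [x] to the degree of [<X, x>]. *)
Lemma pr_mur_at1 a b X c d x f : ha_comp a b X -> bg_comp c d x ->
  at1 (p X (bg_mur f x)) = at1 (p X x) * shift (- a) f.
Proof.
move=> Xab xcd.
rewrite -[in LHS](shift0 f) -(addNr d) -shift_shift (pr_murr p _ _ xcd).
by rewrite at1_fmul (pr_compE _ Xab xcd) shift_shift opprD addrNK.
Qed.
End PairingAtOne.

Section RightCorep.
Context (R : realType) (h : vectType R[i]) (U : halgebra h) (A : coalgebroid h).
Context (p : pairing U A) (V : hspace h) (rho : right_corep A V).

(** The operator [T_b] in [<X, .> T_b] fixes the constant function 1, so it is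
    invisible once a difference operator acts through its value at 1. *)
Definition right_op (X : U) (v : restr V) : restr V :=
  tensor_lift (fun _ _ _ (w : graded_of V) (x : as_right A) =>
    hs_act (at1 (p X x)) w) (rho v).

Let cV := @graded_of_closed R h V.
Let cA := as_right_closed (co_prealgebra A).
Let aV := @hs_actionP R h V.

Lemma right_op_balanced X : balanced
  (fun _ _ _ (w : graded_of V) (x : as_right A) => hs_act (at1 (p X x)) w).
Proof.
apply: bilinear_balanced.
- by move=> i g k x; exact: hs_act_linear.
- move=> i g k w c x y; rewrite (pr_linearr p X) at1_linear; exact: (act_linear aV).
- move=> i g k m w x _ _ /=; have [_ _ _ M] := aV.
  by rewrite pr_mulr at1_mulf -M mulrC.
Qed.

Lemma induced_rightE a b X : ha_comp a b X ->
  induced_right p rho a b X = right_op X.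
Proof.
move=> Xab; apply/funext => v; rewrite /induced_right tensor_unitr_map//.
  by apply: eq_tensor_lift => i g k w x _ _; rewrite at1_mulr.
move=> k g x xA; have := dop_comp_shiftr b (dop_comp_sym (pr_comp p Xab xA)).
by rewrite [b + g]addrC addrK [a + k]addrC.
Qed.

Lemma right_op_linear X : linear (right_op X).
Proof.
have [rl _ _] := rc_hom rho => c u v; rewrite /right_op rl.
exact: (tensor_lift_linear cV cA (right_op_balanced X)).
Qed.

Lemma right_op_linearX : linear right_op.
Proof.
move=> c X Y; apply/funext => v; rewrite !fctE /right_op -tensor_lift_linear_fun.
apply: eq_tensor_lift => i g k w x _ _.
rewrite (pr_linearl p x) at1_linear; exact: (act_linear aV).
Qed.

Lemma right_op_act a b X f v : ha_comp a b X ->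
  right_op X (hs_act f v) = hs_act (shift (- a) f) (right_op X v).
Proof.
move=> Xab; have [_ _ ra] := rc_hom rho; have [_ _ _ M] := aV.
have [_ _ _ pc] := co_prealgebra A.
rewrite /right_op [rho _]ra /= tensor_lift_map//; last 2 first.
- exact: right_op_balanced.
- by move=> i g k e x Ee /(pc _ _ f)[].
rewrite linear_tensor_lift; last exact: hs_act_linear.
apply: eq_tensor_lift => i g k w x wg xgk.
by rewrite -M (pr_mur_at1 p _ Xab xgk) mulrC.
Qed.

Lemma right_op_wt a b X c v : ha_comp a b X -> hs_wt c v ->
  hs_wt (c + a - b) (right_op X v).
Proof.
move=> Xab vc; have [_ /(_ tt c v vc) rv _] := rc_hom rho.
apply: (tensor_lift_comp_ind (Q := [set w : restr V | hs_wt (c + a - b) w])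
  cV cA (right_op_balanced X) rv) => /=.
- exact: hs_wt0.
- exact: hs_wtD.
- move=> g w x wg xA.
  have [gE|gN] := eqVneq g (c + a - b); first by apply: hs_wtZ; rewrite -gE.
  rewrite (dop_comp_neq _ (pr_comp p Xab xA)) ?at10 ?(act0 aV); first exact: hs_wt0.
  by apply: contra gN => /eqP E; rewrite [c + a]addrC E [b + g]addrC addrK.
Qed.

Lemma right_op_dopV a b X : ha_comp a b X -> is_dopV b a (right_op X).
Proof.
move=> Xab; split.
- exact: right_op_linear.
- by move=> f v; exact: right_op_act Xab.
- by move=> c v /(right_op_wt Xab); rewrite addrAC.
Qed.

(** Both sides are sums over the twice iterated corepresentation.  They agree
    term by term because [<X, x> T_g], for [x] of inner degree [g], is a function
    times [T_{-a}], the shift by which [right_op X] commutes with functions. *)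
Lemma right_opM a b X Y v : ha_comp a b X ->
  right_op (X * Y) v = right_op X (right_op Y v).
Proof.
move=> Xab; have [_ rc _] := rc_hom rho; have [_ dc _ _] := Delta_hom A.
have [Vl _ _ VM] := aV; have [_ _ _ pc] := co_prealgebra A.
pose Phi (_ : unit) (_ b' k : dual h) (w : graded_of V) (x : A) (z : as_right A) : restr V :=
  hs_act (val (p X x) (shift b' (at1 (p Y z)))) w.
have bPhi : trilinear_balanced Phi.
  split.
  - by move=> i g b' k x f; exact: Vl.
  - move=> i g b' k w z c x y; rewrite /Phi (pr_linearr p X) /=; exact: (act_linear aV).
  - move=> i g b' k w x c z z'; rewrite /Phi (pr_linearr p Y) at1_linear.
    by rewrite shift_linear diffop_linear; exact: (act_linear aV).
  - move=> i g b' k m w x z _ _; rewrite /Phi pr_mulr /= /dop_fun shift0.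
    by rewrite -VM mulrC.
  - move=> i g b' k m w x z xA zA; rewrite /Phi pr_mulr at1_mulf shiftM.
    rewrite -[m in bg_mur m _]shift0 -(addNr b') -shift_shift (pr_murr p _ _ xA) /=.
    by rewrite /dop_fun shift0.
transitivity (tensor_lift (fun i g k (w : graded_of V) (x : as_right A) =>
  tensor_lift (fun g' b' k' (y : as_left A) (z : as_right A) =>
    Phi i g' b' k' w y z) (Delta A x)) (rho v)).
  apply: eq_tensor_lift => i g k w x _ _.
  rewrite pr_times (linear_tensor_lift (L := fun P => hs_act (at1 P) w)); last first.
    by move=> c P Q; rewrite at1_linear; exact: (act_linear aV).
  apply: eq_tensor_lift => i' g' k' y z _ _.
  by rewrite /Phi at1_dop_mul /= /dop_fun mul1r.
rewrite -(tensor_lift_coassoc cV (co_prealgebra A) cA bPhi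
  (E0 := graded_of V) (F0 := as_right A) (rho := rho) (t := rho v)); last 3 first.
- exact: rc.
- by move=> k g x; exact: dc.
- exact: rc_coassoc.
rewrite [right_op Y v]/right_op (linear_tensor_lift (L := right_op X)); last first.
  exact: right_op_linear.
apply: eq_tensor_lift => i g k w z _ _; rewrite (right_op_act _ _ Xab).
rewrite linear_tensor_lift//.
apply: eq_tensor_lift => i' g' k' e x _ xA; rewrite /Phi -VM.
by rewrite (pr_compE p _ Xab xA) shift_shift opprD addrNK mulrC.
Qed.

Lemma right_op1 v : right_op 1 v = v.
Proof.
have [_ dc _ _] := counit_hom A.
rewrite -[RHS](rc_counit rho) tensor_unitr_map//; last first.
  by move=> k g x; exact: dc.
by apply: eq_tensor_lift => i g k w x _ _; rewrite pr_one.
Qed.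

Lemma right_op_mul f v : right_op (ha_mul U f) v = hs_act f v.
Proof.
have [_ _ _ M] := aV.
rewrite -{2}(right_op1 v) /right_op linear_tensor_lift; last exact: hs_act_linear.
apply: eq_tensor_lift => i g k w x _ _.
by rewrite -[ha_mul U f]mulr1 pr_mull at1_mulf M.
Qed.

Lemma right_op_mur f c v : hs_wt c v ->
  right_op (ha_mur U f) v = hs_act (shift (- c) f) v.
Proof.
move=> vc; have [_ _ _ M] := aV; have [_ /(_ tt c v vc) rv _] := rc_hom rho.
rewrite -[in RHS](right_op1 v) /right_op linear_tensor_lift; last first.
  exact: hs_act_linear.
apply: (eq_tensor_lift_comp cV cA _ _ rv).
- exact: right_op_balanced.
- by apply: linear_balanced; [exact: hs_act_linear|exact: right_op_balanced].
- move=> g w x wg xA.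
  rewrite -[ha_mur U f]mul1r pr_murl at1_fmul.
  by rewrite (pr_compE p _ (ha_one U) xA) add0r -M mulrC.
Qed.

Lemma right_representation : exists pi : U -> opV V,
  [/\ extends (induced_right p rho) pi,
      forall pi' : U -> opV V,
        extends (induced_right p rho) pi' -> pi' = pi,
      @is_halgebra_hom R h (ha_data U) (lr_halgebra (opV_halgebra V)) pi
    & @dynamical_representation R h (lr_halgebra (ha_data U)) V pi].
Proof.
have [|a b X Xab|pi [pil piE]] :=
    @extends_exists R h U V (fun _ _ => right_op).
- by move=> _ _; exact: right_op_linearX.
- by apply: sums_of_sub; exists b, a; exact: right_op_dopV Xab.
have piM : forall X Y, pi (X * Y) = opV_mul (pi X) (pi Y).
  apply: bilinear_ext.
  - by move=> Y c X X'; rewrite mulrDl -scalerAl pil.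
  - by move=> X c Y Y'; rewrite mulrDr -scalerAr pil.
  - by move=> Y c X X'; rewrite pil opV_mul_linearl.
  - by move=> X c Y Y'; rewrite pil opV_mul_linearr.
  move=> a b c d X Y Xab Ycd; apply/val_inj/funext => v /=.
  rewrite (piE _ _ _ (ha_times Xab Ycd)) (piE _ _ _ Xab) (piE _ _ _ Ycd).
  exact: right_opM Xab.
have pi1 : pi 1 = opV1 V.
  by apply/val_inj/funext => v; rewrite (piE _ _ _ (ha_one U)) right_op1.
have pic a b X : ha_comp a b X -> is_dopV b a (val (pi X)).
  by move=> Xab; rewrite (piE _ _ _ Xab); exact: right_op_dopV.
have pimul f : pi (ha_mul U f) = opV_mur V f.
  have [f00 _] := ha_moment00 U f.
  by apply/val_inj/funext => v; rewrite (piE _ _ _ f00) right_op_mul.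
have pimur f : pi (ha_mur U f) = opV_mull V f.
  have [_ f00] := ha_moment00 U f.
  by apply: opV_mullP => c v vc; rewrite (piE _ _ _ f00) (right_op_mur _ vc).
have extpi : extends (induced_right p rho) pi.
  by split=> // a b X Xab; rewrite (piE _ _ _ Xab) induced_rightE.
exists pi; split=> //.
- by move=> pi'; exact: extends_unique.
- by split=> // f; rewrite /= pimul pimur.
- split=> //; [by move=> a b X; exact: pic|by move=> f; rewrite /= pimul pimur].
Qed.
End RightCorep.

Section LeftCorep.
Context (R : realType) (h : vectType R[i]) (U : halgebra h) (A : coalgebroid h).
Context (p : pairing U A) (V : hspace h) (lambda : left_corep A V).

(** Unlike in the right case, the factor [T_a] in [T_a <X, .>] acts on the value
    of [<X, x>] at 1, so the formula depends on the degree of [X]. *)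
Definition left_op (a : dual h) (X : U) (v : restr V) : restr V :=
  tensor_lift (fun _ _ _ (x : as_left A) (w : graded_of V) =>
    hs_act (shift a (at1 (p X x))) w) (lambda v).

Let cV := @graded_of_closed R h V.
Let cA := as_left_closed (co_prealgebra A).
Let aV := @hs_actionP R h V.

Lemma left_op_balanced a b X : ha_comp a b X -> balanced
  (fun _ _ _ (x : as_left A) (w : graded_of V) => hs_act (shift a (at1 (p X x))) w).
Proof.
move=> Xab; apply: bilinear_balanced.
- move=> i g k w c x y; rewrite (pr_linearr p X) at1_linear shift_linear.
  exact: (act_linear aV).
- by move=> i g k x; exact: hs_act_linear.
- move=> i g k m x w xA _; have [_ _ _ M] := aV.
  rewrite [gr_act m x]/(bg_mur m _) (pr_mur_at1 p _ Xab xA).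
  by rewrite shiftM shift_shift subrr shift0 M.
Qed.

Lemma induced_leftE a b X : ha_comp a b X ->
  induced_left p lambda a b X = left_op a X.
Proof.
move=> Xab; apply/funext => v; rewrite /induced_left tensor_unitl_map//.
  by apply: eq_tensor_lift => i g k x w _ _; rewrite at1_mull.
move=> g k x xA; have := dop_comp_shiftl a (dop_comp_sym (pr_comp p Xab xA)).
by rewrite [a + k]addrC addrK [b + g]addrC.
Qed.

Lemma left_op_linear a b X : ha_comp a b X -> linear (left_op a X).
Proof.
move=> Xab; have [rl _ _] := lc_hom lambda => c u v; rewrite /left_op rl.
exact: (tensor_lift_linear cA cV (left_op_balanced Xab)).
Qed.

Lemma left_op_linearX a : linear (left_op a).
Proof.
move=> c X Y; apply/funext => v; rewrite !fctE /left_op -tensor_lift_linear_fun.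
apply: eq_tensor_lift => i g k x w _ _.
rewrite (pr_linearl p x) at1_linear shift_linear; exact: (act_linear aV).
Qed.

Lemma left_op_act a b X f v : ha_comp a b X ->
  left_op a X (hs_act f v) = hs_act (shift a f) (left_op a X v).
Proof.
move=> Xab; have [_ _ ra] := lc_hom lambda; have [_ _ _ M] := aV.
have [_ _ _ pc] := co_prealgebra A.
rewrite /left_op [lambda _]ra /= tensor_lift_map//; last 2 first.
- exact: left_op_balanced Xab.
- by move=> i g k e x /(pc _ _ f)[].
rewrite linear_tensor_lift; last exact: hs_act_linear.
by apply: eq_tensor_lift => i g k x w xA _; rewrite -M -shiftM pr_mulr at1_mulf.
Qed.

Lemma left_op_wt a b X c v : ha_comp a b X -> hs_wt c v ->
  hs_wt (c + b - a) (left_op a X v).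
Proof.
move=> Xab vc; have [_ /(_ tt c v vc) rv _] := lc_hom lambda.
apply: (tensor_lift_comp_ind (Q := [set w : restr V | hs_wt (c + b - a) w])
  cA cV (left_op_balanced Xab) rv) => /=.
- exact: hs_wt0.
- exact: hs_wtD.
- move=> g x w xA wg.
  have [gE|gN] := eqVneq g (c + b - a); first by apply: hs_wtZ; rewrite -gE.
  rewrite (dop_comp_neq _ (pr_comp p Xab xA)) ?at10 ?shift00 ?(act0 aV).
    exact: hs_wt0.
  by apply: contra gN => /eqP E; rewrite [c + b]addrC -E [a + g]addrC addrK.
Qed.

Lemma left_op_dopV a b X : ha_comp a b X -> is_dopV (- b) (- a) (left_op a X).
Proof.
move=> Xab; split.
- exact: left_op_linear Xab.
- by move=> f v; rewrite opprK; exact: left_op_act Xab.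
- by move=> c v /(left_op_wt Xab); rewrite opprK.
Qed.

(** Products are reversed because the pairing of [X * Y] evaluates [X] on the
    first Sweedler factor, which comes from the first application of the
    corepresentation; the coefficient it produces is then shifted by [T_c] when
    [Y] acts. *)
Lemma left_opM a b c d X Y v : ha_comp a b X -> ha_comp c d Y ->
  left_op (a + c) (X * Y) v = left_op c Y (left_op a X v).
Proof.
move=> Xab Ycd; have [_ lc _] := lc_hom lambda; have [_ dc _ _] := Delta_hom A.
have [Vl _ _ VM] := aV; have [_ _ _ pc] := co_prealgebra A.
(* For [x] of inner degree [g] the coefficient is the value at 1 of
   [T_{a + c} <X, x> T_g <Y, y>]; in this factored form it is balanced in [y]
   and [w] for every [x]. *)
pose Phi (_ g _ : dual h) (_ : unit) (x : as_left A) (y : A) (w : graded_of V) :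
    restr V :=
  hs_act (shift (a + c) (at1 (p X x)) * shift c (at1 (p Y y))) w.
have bPhi : trilinear_balanced Phi.
  split.
  - move=> i g b' k y w e x x'.
    rewrite /Phi (pr_linearr p X) at1_linear shift_linear mulrDl -scalerAl.
    exact: (act_linear aV).
  - move=> i g b' k x w e y y'.
    rewrite /Phi (pr_linearr p Y) at1_linear shift_linear mulrDr -scalerAr.
    exact: (act_linear aV).
  - by move=> i g b' k x y; exact: Vl.
  - move=> i g b' k m x y w xA _.
    rewrite /Phi [gr_act m x]/(bg_mur m _) (pr_mur_at1 p _ Xab xA) pr_mulr at1_mulf.
    by rewrite !shiftM shift_shift addrAC subrr add0r mulrA.
  - move=> i g b' k m x y w yA _.
    rewrite /Phi (pr_mur_at1 p _ Ycd yA) shiftM shift_shift subrr shift0 mulrA.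
    by rewrite VM.
transitivity (tensor_lift (fun i b' k (t : as_left A) (w : graded_of V) =>
  tensor_lift (fun i' g b'' (x : as_left A) (y : as_right A) =>
    Phi i' g b'' k x y w) (Delta A t)) (lambda v)).
  apply: eq_tensor_lift => i g k t w _ _.
  rewrite pr_times.
  rewrite (linear_tensor_lift (L := fun P => hs_act (shift (a + c) (at1 P)) w)); last first.
    by move=> e P Q; rewrite at1_linear shift_linear; exact: (act_linear aV).
  apply: eq_tensor_lift => i' g' k' x y xA _.
  rewrite /Phi at1_dop_mul /= /dop_fun mul1r (pr_compE p _ Xab xA) shiftM.
  by rewrite !shift_shift opprD addrACA subrr add0r addrNK.
rewrite (tensor_lift_coassoc cA (co_prealgebra A) cV bPhi
  (E0 := as_left A) (F0 := graded_of V) (lam := lambda) (t' := lambda v)); last 3 first.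
- by move=> k g x; exact: dc.
- exact: lc.
- exact: lc_coassoc.
rewrite [left_op a X v]/left_op (linear_tensor_lift (L := left_op c Y)); last first.
  exact: left_op_linear Ycd.
apply: eq_tensor_lift => i g k x w _ _; rewrite (left_op_act _ _ Ycd).
rewrite linear_tensor_lift//.
by apply: eq_tensor_lift => i' g' k' y e _ _; rewrite /Phi -VM shift_shift addrC.
Qed.

Lemma left_op1 v : left_op 0 1 v = v.
Proof.
have [_ dc _ _] := counit_hom A.
rewrite -[RHS](lc_counit lambda) tensor_unitl_map//.
by apply: eq_tensor_lift => i g k w x _ _; rewrite pr_one shift0.
Qed.

Lemma left_op_mul f v : left_op 0 (ha_mul U f) v = hs_act f v.
Proof.
have [_ _ _ M] := aV.
rewrite -{2}(left_op1 v) /left_op linear_tensor_lift; last exact: hs_act_linear.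
apply: eq_tensor_lift => i g k w x _ _.
by rewrite -[ha_mul U f]mulr1 pr_mull !shift0 at1_mulf M.
Qed.

Lemma left_op_mur f c v : hs_wt c v ->
  left_op 0 (ha_mur U f) v = hs_act (shift (- c) f) v.
Proof.
move=> vc; have [_ _ _ M] := aV; have [_ /(_ tt c v vc) rv _] := lc_hom lambda.
rewrite -[in RHS](left_op1 v) /left_op linear_tensor_lift; last first.
  exact: hs_act_linear.
have [_ f00] := ha_moment00 U f.
apply: (eq_tensor_lift_comp cA cV _ _ rv).
- exact: left_op_balanced f00.
- apply: linear_balanced; first exact: hs_act_linear.
  exact: left_op_balanced (ha_one U).
- move=> g x w xA _; rewrite !shift0.
  (* for [g <> c] both pairings vanish for degree reasons *)
  have [xg|xg] := eqVneq g c.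
    subst g; rewrite -[ha_mur U f]mul1r pr_murl at1_fmul.
    by rewrite (pr_compE p _ (ha_one U) xA) add0r -M mulrC.
  have x0 Y : ha_comp 0 0 Y -> at1 (p Y x) = 0.
    move=> Y00; rewrite (dop_comp_neq _ (pr_comp p Y00 xA)) ?at10//.
    by rewrite !add0r.
  rewrite !x0//; last exact: ha_one.
  by rewrite -M mulr0.
Qed.

Lemma left_representation : exists pi : U -> opV V,
  [/\ extends (induced_left p lambda) pi,
      forall pi' : U -> opV V,
        extends (induced_left p lambda) pi' -> pi' = pi,
      @is_halgebra_hom R h (opp_halgebra (ha_data U)) (lr_halgebra (opV_halgebra V)) pi
    & @dynamical_representation R h (lr_halgebra (opp_halgebra (ha_data U))) V pi].
Proof.
have [|a b X Xab|pi [pil piE]] :=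
    @extends_exists R h U V (fun a _ => left_op a).
- by move=> a _; exact: left_op_linearX.
- by apply: sums_of_sub; exists (- b), (- a); exact: left_op_dopV Xab.
have piM : forall X Y, pi (Y * X) = opV_mul (pi X) (pi Y).
  apply: bilinear_ext.
  - by move=> Y c X X'; rewrite mulrDr -scalerAr pil.
  - by move=> X c Y Y'; rewrite mulrDl -scalerAl pil.
  - by move=> Y c X X'; rewrite pil opV_mul_linearl.
  - by move=> X c Y Y'; rewrite pil opV_mul_linearr.
  move=> a b c d X Y Xab Ycd; apply/val_inj/funext => v /=.
  rewrite (piE _ _ _ (ha_times Ycd Xab)) (piE _ _ _ Xab) (piE _ _ _ Ycd).
  exact: left_opM Ycd Xab.
have pi1 : pi 1 = opV1 V.
  by apply/val_inj/funext => v; rewrite (piE _ _ _ (ha_one U)) left_op1.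
have pic a b X : ha_comp (- a) (- b) X -> is_dopV b a (val (pi X)).
  move=> Xab; rewrite (piE _ _ _ Xab).
  by have := left_op_dopV Xab; rewrite !opprK.
have pimul f : pi (ha_mul U f) = opV_mur V f.
  have [f00 _] := ha_moment00 U f.
  by apply/val_inj/funext => v; rewrite (piE _ _ _ f00) left_op_mul.
have pimur f : pi (ha_mur U f) = opV_mull V f.
  have [_ f00] := ha_moment00 U f.
  by apply: opV_mullP => c v vc; rewrite (piE _ _ _ f00) (left_op_mur _ vc).
have extpi : extends (induced_left p lambda) pi.
  by split=> // a b X Xab; rewrite (piE _ _ _ Xab) (induced_leftE Xab).
exists pi; split=> //.
- by move=> pi'; exact: extends_unique.
- by split=> // f; rewrite /= pimul pimur.
- split=> //; [by move=> a b X; exact: pic|by move=> f; rewrite /= pimul pimur].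
Qed.
End LeftCorep.

(** * The antipode of a Hopf algebroid *)

Section Antipode.
Context (R : realType) (h : vectType R[i]) (U : halgebra h).
Context (H : hopf_algebroid U).

Let S : U -> U := antipode H.
Let eps (x : U) : Mero h := at1 (counit H x).
Let D (x : U) := Delta H x.
Let bg := ha_bg U.
Let pU : is_prealgebra bg := ha_prealgebra U.
Let cl := as_left_closed pU.
Let cr := as_right_closed pU.
Let Slin : linear S := antipode_linear H.

Let mull_lin (y : U) : linear (fun x : U => x * y).
Proof. by move=> c x x'; rewrite mulrDl -scalerAl. Qed.

Let mulr_lin (x : U) : linear (fun y : U => x * y).
Proof. by move=> c y y'; rewrite mulrDr -scalerAr. Qed.

Let eps_lin : linear eps.
Proof.
have [cl' _ _ _] := counit_hom H.
by move=> c x y; rewrite /eps cl' at1_linear.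
Qed.

Lemma counit_comp a b x : ha_comp a b x -> dop_comp a b (counit H x).
Proof. by have [_ cc _ _] := counit_hom H; exact: cc. Qed.

Lemma eps_neq a b x : a != b -> ha_comp a b x -> eps x = 0.
Proof. by move=> ab /counit_comp /(dop_comp_neq ab); rewrite /eps => ->. Qed.

Lemma eps_murr f x : eps (ha_mur U f * x) = f * eps x.
Proof. by have [_ _ _ cm] := counit_hom H; rewrite /eps cm at1_mulf. Qed.

Lemma epsM a b x y : ha_comp a b x -> eps (x * y) = eps x * shift (- a) (eps y).
Proof.
move=> xab; have [_ [cM _] _ _] := hopf_counit H.
by rewrite /eps cM at1_dop_mul (dop_compE _ (counit_comp xab)).
Qed.

Lemma eps1 : eps 1 = 1.
Proof.
have [_ [_ c1] _ _] := hopf_counit H.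
by rewrite /eps c1 /at1 /= /dop_fun shift1 mulr1.
Qed.

Lemma ha_murM f g : ha_mur U (f * g) = ha_mur U f * ha_mur U g.
Proof.
have [_ [_ [_ _ _ M]] _ _] := pU.
by have /= := M f g 1; rewrite !mulr1.
Qed.

Lemma ha_mul1 : ha_mul U 1 = 1.
Proof. by have [_ [aU _] _ _] := pU; have /= := act1 aU 1; rewrite mulr1. Qed.

Lemma ha_mul_linear : linear (ha_mul U).
Proof.
have [_ [aU _] _ _] := pU => c f g.
by have /= := act_linear aU 1 c f g; rewrite !mulr1.
Qed.

Lemma ha_mur_linear : linear (ha_mur U).
Proof.
have [_ [_ aU] _ _] := pU => c f g.
by have /= := act_linear aU 1 c f g; rewrite !mulr1.
Qed.

Lemma ha_mul0 : ha_mul U 0 = 0. Proof. exact: linear_map0 ha_mul_linear. Qed.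
Lemma ha_mur0 : ha_mur U 0 = 0. Proof. exact: linear_map0 ha_mur_linear. Qed.

Lemma ha_mulC a b f x : ha_comp a b x -> x * ha_mul U f = ha_mul U (shift (- a) f) * x.
Proof.
by move=> xab; have [-> _] := ha_moment (shift (- a) f) xab; rewrite shift_shift subrr shift0.
Qed.

Lemma ha_murC a b f x : ha_comp a b x -> x * ha_mur U f = ha_mur U (shift (- b) f) * x.
Proof.
by move=> xab; have [_ ->] := ha_moment (shift (- b) f) xab; rewrite shift_shift subrr shift0.
Qed.

Lemma antipode_mulr a b f x : ha_comp a b x ->
  S (ha_mul U f * x) = ha_mur U (shift a f) * S x.
Proof. by move=> xab; have [-> _] := ha_moment f xab; exact: antipode_mul. Qed.

Lemma antipode_balancedl : balanced
  (fun _ _ _ (y : as_left bg) (z : as_right bg) => S y * (z : U)).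
Proof.
apply: bilinear_balanced.
- by move=> i g k z c y y'; rewrite Slin mulrDl -scalerAl.
- by move=> i g k y; exact: mulr_lin.
- move=> i g k m y z _ _ /=.
  by rewrite [S _](antipode_mur H) mulrA.
Qed.

Lemma antipode_balancedr : balanced
  (fun _ _ _ (y : as_left bg) (z : as_right bg) => (y : U) * S z).
Proof.
apply: bilinear_balanced.
- by move=> i g k z; exact: mull_lin.
- by move=> i g k y c z z'; rewrite Slin mulrDr -scalerAr.
- move=> i g k m y z yA zA /=; rewrite (antipode_mulr _ zA) mulrA.
  by have [_ ->] := ha_moment m yA.
Qed.

(** This identity and the next one are the images under [S] of the two counit
    identities; they collapse a Sweedler sum once an antipode axiom has turned
    two of its factors into a counit. *)
Lemma antipode_counitl x :
  tensor_lift (fun i _ _ (y : as_left bg) (z : as_right bg) =>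
    ha_mur U (shift i (eps y)) * S z) (D x) = S x.
Proof.
rewrite -[in RHS](counitl_lift pU H x) (linear_tensor_lift (L := S))//.
apply: eq_tensor_lift => i g k y z yA zA /=; rewrite (antipode_mulr _ zA).
have [-> //|ig] := eqVneq i g.
by rewrite -/(eps y) (eps_neq ig yA) !shift00 ha_mur0 !mul0r.
Qed.

Lemma antipode_counitr x y :
  tensor_lift (fun _ _ _ (x1 : as_left bg) (x2 : as_right bg) =>
    S ((x1 : U) * y) * ha_mul U (eps x2)) (D x) = S (x * y).
Proof.
rewrite -[in RHS](counitr_lift pU H x).
rewrite (linear_tensor_lift (L := fun x : U => S (x * y))); last first.
  by move=> c x1 x2; rewrite mulrDl -scalerAl Slin.
apply: eq_tensor_lift => i g k x1 x2 _ _ /=.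
by rewrite -mulrA [S (_ * (_ * _))](antipode_mur H).
Qed.

Lemma homogeneous_projection a b : exists Pr : U -> U,
  [/\ linear Pr, forall x, ha_comp a b x -> Pr x = x
    & forall c d x, (c, d) != (a, b) -> ha_comp c d x -> Pr x = 0].
Proof.
have [dsU _ _ _] := pU.
have glin (cd : dual h * dual h) : linear (fun x : U => if cd == (a, b) then x else 0).
  by move=> c x y; case: eqP; rewrite // scaler0 addr0.
have [Pr Prl PrE] := direct_sum_lift dsU glin.
exists Pr; split=> // [x xab|c d x cd xcd]; first by rewrite (PrE (a, b))// eqxx.
by rewrite (PrE (c, d))// (negPf cd).
Qed.

Let Pr a b := projT1 (cid (homogeneous_projection a b)).

Let Pr_linear a b : linear (Pr a b).
Proof. by rewrite /Pr; case: cid => ? []. Qed.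

Let Pr_id a b x : ha_comp a b x -> Pr a b x = x.
Proof. by rewrite /Pr; case: cid => ? [] /= _ + _; exact. Qed.

Let Pr_neq a b c d x : (c, d) != (a, b) -> ha_comp c d x -> Pr a b x = 0.
Proof. by rewrite /Pr; case: cid => ? [] /= _ _; exact. Qed.

Let ha_comp0 a b : @ha_comp _ _ U a b 0.
Proof. by have [[W0 _ _] _ _ _] := pU; case: (W0 (a, b)). Qed.

Let ha_compD a b x y :
  @ha_comp _ _ U a b x -> ha_comp a b y -> ha_comp a b (x + y).
Proof. by have [cD _ _] := cl a b; exact: cD. Qed.

Let Pr_comp a b x : ha_comp a b (Pr a b x).
Proof.
move: x; apply: (prealgebra_ind pU) => [|x y Px Py|c d x xcd].
- by rewrite (linear_map0 (Pr_linear a b)).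
- by rewrite (linear_mapD (Pr_linear a b)); exact: ha_compD.
- have [cd|cd] := eqVneq (c, d) (a, b).
    by case: cd xcd => -> -> xab; rewrite Pr_id.
  by rewrite (Pr_neq cd xcd).
Qed.

Let Pr_mul c d a b y s : ha_comp c d y ->
  y * Pr a b s = Pr (c + a) (d + b) (y * s).
Proof.
move=> ycd; move: s.
have /(congr1 (@^~ _)) H1 : (fun s => y * Pr a b s) =
    (fun s => Pr (c + a) (d + b) (y * s)); last by move=> s; exact: H1.
apply: (prealgebra_ext pU).
- by move=> k s s'; rewrite Pr_linear mulrDr -scalerAr.
- by move=> k s s'; rewrite mulrDr -scalerAr Pr_linear.
move=> a' b' s sab; have ysab := ha_times ycd sab.
have [E|N] := eqVneq (a', b') (a, b).
  by case: E sab ysab => -> -> sab ysab; rewrite !Pr_id.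
rewrite (Pr_neq N sab) mulr0 (Pr_neq _ ysab)//.
by apply: contra N => /eqP [/addrI -> /addrI ->].
Qed.

(** [S x = sum S(x1) x2 S(x3)], and in [sum x2 S(x3)], being the homogeneous
    element [mu_l (eps x2)], only one component of [S(x3)] contributes.  So [S]
    may be replaced by that component in the last factor, after which the
    antipode axiom absorbs the first two factors. *)
Lemma antipode_comp a b x : ha_comp a b x -> ha_comp (- b) (- a) (S x).
Proof.
move=> xab.
pose Phi (_ g b' k : dual h) (x : U) (y : U) (z : U) : U :=
  S x * (y * Pr (- k) (- b') (S z)).
have bPhi : trilinear_balanced (E := as_left bg) (A := bg) (F := as_right bg) Phi.
  split.
  - by move=> i g b' k y z c x1 x2; rewrite /Phi Slin mulrDl -scalerAl.
  - by move=> i g b' k x1 z c y y'; rewrite /Phi mulrDl -scalerAl mulrDr -scalerAr.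
  - by move=> i g b' k x1 y c z z'; rewrite /Phi Slin Pr_linear !mulrDr -!scalerAr.
  - move=> i g b' k m x1 y z _ _ /=.
    by rewrite /Phi [S (_ * _)](antipode_mur H) !mulrA.
  - move=> i g b' k m x1 y z yA zA /=; rewrite /Phi (antipode_mulr _ zA).
    have [_ f00] := ha_moment00 U (shift b' m).
    have [_ ->] := ha_moment m yA; rewrite -!mulrA; congr (_ * (_ * _)).
    by rewrite (Pr_mul _ _ _ f00) !add0r.
have Sx : S x = tensor_lift (fun i b' k (t : as_left bg) (z : as_right bg) =>
    ha_mur U (shift i (eps t)) * Pr (- k) (- b') (S z)) (D x).
  rewrite -[x in LHS]mulr1 -antipode_counitr.
  transitivity (tensor_lift (fun i g k (x1 : as_left bg) (t : as_right bg) =>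
    tensor_lift (fun g' b' k' (y : as_left bg) (z : as_right bg) =>
      Phi i g' b' k' x1 y z) (D t)) (D x)).
    apply: eq_tensor_lift => i g k x1 t _ tA; rewrite mulr1.
    have -> : ha_mul U (eps t) = Pr (g - k) 0 (ha_mul U (eps t)).
      have [f00 _] := ha_moment00 U (eps t).
      have [gk|gk] := eqVneq g k; first by rewrite gk subrr Pr_id.
      by rewrite (eps_neq gk tA) ha_mul0 (linear_map0 (Pr_linear _ _)).
    rewrite -(antipode_right H t) (linear_tensor_lift (L := Pr _ _))//.
    rewrite -[RHS](linear_tensor_lift (L := fun u => S x1 * u)); last exact: mulr_lin.
    congr (_ * _); have [_ Dc _ _] := Delta_hom H.
    apply: (eq_tensor_lift_comp cl cr _ _ (Dc _ _ _ tA)).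
    - by apply: linear_balanced => //; exact: antipode_balancedr.
    - apply: bilinear_balanced.
      + by move=> i' g' k' z; exact: mull_lin.
      + by move=> i' g' k' y c z z'; rewrite Slin Pr_linear mulrDr -scalerAr.
      + move=> i' g' k' m y z yA zA /=; rewrite (antipode_mulr _ zA).
        have [_ f00] := ha_moment00 U (shift g' m).
        have [_ ->] := ha_moment m yA; rewrite -!mulrA; congr (_ * _).
        by rewrite (Pr_mul _ _ _ f00) !add0r.
    - by move=> b' y z yA zA; rewrite (Pr_mul _ _ _ yA) subrr.
  rewrite -(Delta_coassoc_lift pU H x bPhi).
  apply: eq_tensor_lift => i b' k t z tA zA.
  rewrite -(antipode_left H tA) (linear_tensor_lift (L := fun u => u * _)); last first.
    exact: mull_lin.
  have [_ Dc _ _] := Delta_hom H.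
  apply: (eq_tensor_lift_comp cl cr _ _ (Dc _ _ _ tA)).
  - exact: (trilinear_balanced_left bPhi).
  - exact: (linear_balanced (mull_lin (Pr (- k) (- b') (S z))) antipode_balancedl).
  - by move=> g y y' yA y'A; rewrite /Phi mulrA.
rewrite Sx; have [_ Dc _ _] := Delta_hom H.
apply: (tensor_lift_comp_ind cl cr _ (Dc _ _ _ xab)).
- apply: bilinear_balanced.
  + move=> i g k z c y y'; rewrite eps_lin shift_linear ha_mur_linear.
    by rewrite mulrDl -scalerAl.
  + by move=> i g k y c z z'; rewrite Slin Pr_linear mulrDr -scalerAr.
  + move=> i g k m y z yA zA /=; rewrite [eps _]eps_murr (antipode_mulr _ zA).
    have [<-|ig] := eqVneq i g; last first.
      by rewrite (eps_neq ig yA) mulr0 shift00 ha_mur0 !mul0r.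
    have [_ f00] := ha_moment00 U (shift i m).
    have -> : Pr (- k) (- i) (ha_mur U (shift i m) * S z) =
        ha_mur U (shift i m) * Pr (- k) (- i) (S z).
      by rewrite (Pr_mul _ _ _ f00) !add0r.
    by rewrite mulrA -ha_murM shiftM [shift i m * _]mulrC.
- exact: ha_comp0.
- by move=> u v; exact: ha_compD.
- move=> g t z tA zA; have [ag|ag] := eqVneq a g; last first.
    by rewrite (eps_neq ag tA) shift00 ha_mur0 mul0r; exact: ha_comp0.
  have [_ f00] := ha_moment00 U (shift a (eps t)).
  by rewrite -ag; have := ha_times f00 (Pr_comp (- b) (- a) (S z)); rewrite !add0r.
Qed.

(** A function can be moved from [y], inside the antipode, to the other side of
    [x2], because [x1] and [x2] share the inner degree [g]. *)
Let antipode_mul_bal i g k (x1 x2 y : U) f : ha_comp i g x1 -> ha_comp g k x2 ->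
  S (x1 * (ha_mur U f * y)) * x2 = S (x1 * y) * (x2 * ha_mul U f).
Proof.
move=> x1A x2A; rewrite mulrA (ha_murC f x1A) -mulrA [S (_ * _)](antipode_mur H).
by rewrite -mulrA (ha_mulC _ x2A).
Qed.

(** Multiplicativity of the coproduct, seen through the antipode axiom for a
    product. *)
Lemma antipode_left_mul a b c d x y : ha_comp a b x -> ha_comp c d y ->
  tensor_lift (fun _ _ _ (x1 : as_left bg) (x2 : as_right bg) =>
    tensor_lift (fun _ _ _ (y1 : as_left bg) (y2 : as_right bg) =>
      S ((x1 : U) * (y1 : U)) * ((x2 : U) * (y2 : U))) (D y)) (D x) =
  ha_mur U (shift (a + c) (eps (x * y))).
Proof.
move=> xab ycd; rewrite -(antipode_left H (ha_times xab ycd)).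
have [_ [DM _] _ _] := hopf_Delta H; rewrite [Delta H (x * y)]DM /=.
have lin := tensor_lift_linear cl cr antipode_balancedl.
rewrite (linear_tensor_lift _ _ lin).
apply: eq_tensor_lift => i g k x1 x2 x1A x2A; rewrite (linear_tensor_lift _ _ lin).
apply: eq_tensor_lift => i' g' k' y1 y2 y1A y2A.
rewrite (tensor_lift_pure cl cr antipode_balancedl)//.
  exact: ha_times x1A y1A.
exact: ha_times x2A y2A.
Qed.

(** Evaluate [sum S(x1 y1) x2 y2 S(y3)] in two ways.  The antipode axiom for
    [y2], [y3] leaves [sum S(x1 y) x2]; the one for the products [x y1] leaves
    [mu_r(T eps(x)) sum mu_r(T eps(y1)) S(y2)], where the second factor is [S y],
    and the degree of [S(y2)] accounts for the shift when it is moved to the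
    left. *)
Lemma antipode_mul_left a b x y : ha_comp a b x ->
  tensor_lift (fun _ _ _ (x1 : as_left bg) (x2 : as_right bg) =>
    S ((x1 : U) * y) * (x2 : U)) (D x) = S y * ha_mur U (shift a (eps x)).
Proof.
move=> xab.
pose Phi (_ _ _ _ : dual h) (y1 y2 y3 : U) : U :=
  tensor_lift (fun _ _ _ (x1 : as_left bg) (x2 : as_right bg) =>
    S ((x1 : U) * y1) * ((x2 : U) * (y2 * S y3))) (D x).
have bPhi : trilinear_balanced (E := as_left bg) (A := bg) (F := as_right bg) Phi.
  split.
  - move=> i g b' k y2 y3 c y1 y1'; rewrite /Phi -tensor_lift_linear_fun.
    apply: eq_tensor_lift => *.
    by rewrite mulrDr -scalerAr Slin mulrDl -scalerAl.
  - move=> i g b' k y1 y3 c y2 y2'; rewrite /Phi -tensor_lift_linear_fun.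
    apply: eq_tensor_lift => *.
    by rewrite mulrDl -scalerAl !mulrDr -!scalerAr.
  - move=> i g b' k y1 y2 c y3 y3'; rewrite /Phi -tensor_lift_linear_fun.
    apply: eq_tensor_lift => *.
    by rewrite Slin !mulrDr -!scalerAr.
  - move=> i g b' k m y1 y2 y3 _ _; apply: eq_tensor_lift => i' g' k' x1 x2 x1A x2A.
    by rewrite /= 2!mulrA (antipode_mul_bal _ _ x1A x2A) -!mulrA.
  - move=> i g b' k m y1 y2 y3 y2A y3A; apply: eq_tensor_lift => *.
    rewrite /= (antipode_mulr _ y3A); have [_ ->] := ha_moment m y2A.
    by rewrite -!mulrA.
have := Delta_coassoc_lift pU H y bPhi.
set lhs := tensor_lift _ _; set rhs := tensor_lift _ _ => E.
transitivity rhs.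
  rewrite /rhs -[in LHS](counitr_lift pU H y).
  transitivity (tensor_lift (fun _ _ _ (x1 : as_left bg) (x2 : as_right bg) =>
    tensor_lift (fun _ _ _ (y1 : as_left bg) (t : as_right bg) =>
      S ((x1 : U) * (ha_mur U (eps t) * (y1 : U))) * (x2 : U)) (D y)) (D x)).
    apply: eq_tensor_lift => i g k x1 x2 _ _.
    by rewrite (linear_tensor_lift (L := fun u => S ((x1 : U) * u) * (x2 : U))) // => c u v;
      rewrite mulrDr -scalerAr Slin mulrDl -scalerAl.
  rewrite exchange_tensor_lift; apply: eq_tensor_lift => i g k y1 t _ _.
  rewrite /Phi exchange_tensor_lift; apply: eq_tensor_lift => i' g' k' x1 x2 x1A x2A.
  rewrite (antipode_mul_bal _ _ x1A x2A) -(antipode_right H t).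
  rewrite (linear_tensor_lift (L := fun u => S ((x1 : U) * (y1 : U)) * ((x2 : U) * u)))//.
  by move=> c u v; rewrite !mulrDr -!scalerAr.
rewrite -E /lhs -antipode_counitl.
rewrite (linear_tensor_lift (L := fun u : U => u * _)); last exact: mull_lin.
apply: eq_tensor_lift => i g k t z tA zA.
transitivity (ha_mur U (shift (a + i) (eps (x * t))) * S z).
  rewrite -(antipode_left_mul xab tA) exchange_tensor_lift.
  rewrite (linear_tensor_lift (L := fun u : U => u * _)); last exact: mull_lin.
  apply: eq_tensor_lift => i' g' k' y1 y2 _ _; rewrite /Phi.
  rewrite (linear_tensor_lift (L := fun u : U => u * _)); last exact: mull_lin.
  by apply: eq_tensor_lift => *; rewrite -!mulrA.
rewrite (epsM _ xab) shiftM shift_shift addrAC subrr add0r ha_murM -!mulrA.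
have [ig|ig] := eqVneq i g; last first.
  by rewrite (eps_neq ig tA) shift00 ha_mur0 !mul0r mulr0.
rewrite (ha_murC _ (antipode_comp zA)) opprK shift_shift -ig mulrA -ha_murM.
by rewrite mulrA -ha_murM mulrC [a + i]addrC.
Qed.

(** Evaluate [sum S(x1 y) x2 S(x3)] in two ways: the antipode axiom for [x2],
    [x3] leaves [S (x y)], while [antipode_mul_left] for [x1], [x2] leaves
    [S(y) sum mu_r(T eps(x1)) S(x2)], which is [S y * S x]. *)
Lemma antipodeM x y : S (x * y) = S y * S x.
Proof.
pose Phi (_ _ _ _ : dual h) (x1 x2 x3 : U) : U := S (x1 * y) * (x2 * S x3).
have bPhi : trilinear_balanced (E := as_left bg) (A := bg) (F := as_right bg) Phi.
  split.
  - by move=> *  c x1 x1'; rewrite /Phi mulrDl -scalerAl Slin mulrDl -scalerAl.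
  - by move=> * c x2 x2'; rewrite /Phi mulrDl -scalerAl mulrDr -scalerAr.
  - by move=> * c x3 x3'; rewrite /Phi Slin !mulrDr -!scalerAr.
  - move=> i g b k m x1 x2 x3 _ _.
    by rewrite /Phi /= -mulrA [S (_ * (_ * _))](antipode_mur H) !mulrA.
  - move=> i g b k m x1 x2 x3 x2A x3A.
    by rewrite /Phi /= (antipode_mulr _ x3A); have [_ ->] := ha_moment m x2A; rewrite -!mulrA.
have := Delta_coassoc_lift pU H x bPhi.
set lhs := tensor_lift _ _; set rhs := tensor_lift _ _ => E.
transitivity rhs.
  rewrite -antipode_counitr; apply: eq_tensor_lift => i g k x1 t _ _.
  by rewrite -(antipode_right H t) (linear_tensor_lift (L := fun u => S ((x1 : U) * y) * u)).
rewrite -E /lhs -(antipode_counitl x) (linear_tensor_lift (L := fun u => S y * u))//.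
apply: eq_tensor_lift => i b k t z tA _; rewrite mulrA -(antipode_mul_left _ tA).
rewrite (linear_tensor_lift (L := fun u : U => u * S z)); last exact: mull_lin.
by apply: eq_tensor_lift => *; rewrite /Phi mulrA.
Qed.

Lemma antipode1 : S 1 = 1.
Proof.
have [_ [_ D1] _ _] := hopf_Delta H.
have := antipode_right H 1; rewrite [Delta H 1]D1 /=.
rewrite (tensor_lift_pure cl cr antipode_balancedr); last 2 first.
- exact: ha_one.
- exact: ha_one.
by have eps1' : val (counit H 1 : diffop h) 1 = 1 := eps1; rewrite mul1r eps1' ha_mul1.
Qed.

Lemma antipode_moment f : S (ha_mul U f) = ha_mur U f /\ S (ha_mur U f) = ha_mul U f.
Proof.
split.
  by rewrite -[ha_mul U f]mul1r [S _](antipode_mul H) -/S antipode1 mulr1.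
by rewrite -[ha_mur U f]mulr1 [S _](antipode_mur H) -/S antipode1 mul1r.
Qed.

End Antipode.

(** * Both representations, and the twist by the antipode *)

Theorem proposition5p1 (R : realType) (h : vectType R[i])
    (U : halgebra h) (A : coalgebroid h) (p : pairing U A) (V : hspace h) :
  (forall rho : right_corep A V,
     exists pi : U -> opV V,
       [/\ extends (induced_right p rho) pi,
           forall pi' : U -> opV V,
             extends (induced_right p rho) pi' -> pi' = pi,
           @is_halgebra_hom R h (ha_data U) (lr_halgebra (opV_halgebra V)) pi
         & @dynamical_representation R h (lr_halgebra (ha_data U)) V pi])
  /\
  (forall lambda : left_corep A V,
     exists pi : U -> opV V,
       [/\ extends (induced_left p lambda) pi,
           forall pi' : U -> opV V,
             extends (induced_left p lambda) pi' -> pi' = pi,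
           @is_halgebra_hom R h (opp_halgebra (ha_data U)) (lr_halgebra (opV_halgebra V)) pi,
           @dynamical_representation R h (lr_halgebra (opp_halgebra (ha_data U))) V pi
         & forall H : hopf_algebroid U,
             @dynamical_representation R h (ha_data U) V
               (fun X => pi (antipode H X))]).
Proof.
split=> [rho|lambda]; first exact: right_representation.
have [pi [ext uniq hom rep]] := left_representation p lambda.
exists pi; split=> // H.
have [pil [piM pi1] pic pim] := rep.
split.
- by move=> c X Y; rewrite antipode_linear pil.
- split=> [X Y|]; last by rewrite /= antipode1 pi1.
  by rewrite /= antipodeM; exact: (piM (antipode H X) (antipode H Y)).
- move=> a b X Xab; apply: pic => /=; exact: antipode_comp.
- by move=> f; rewrite /=; have [-> ->] := antipode_moment H f; have [] := pim f.
Qed.
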